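(* Let $d=2j+1$ be a positive odd integer ($j\ge 0$ an integer) and let $\sigma=\begin{pmatrix} a & b\\ b & c\end{pmatrix}$ be a real symmetric positive definite matrix. Then the discrete Fourier transform of the periodic Gaussian function of two discrete variables $\mathbf{g}_\sigma:\mathbb{Z}\times\mathbb{Z}\to\mathbb{R}$ satisfies $$\mathbf{F}[\mathbf{g}_\sigma]=\frac{1}{\sqrt{\det\sigma}}\,\mathbf{g}_{\sigma^{-1}},$$ as an equality of functions on $\mathbb{Z}\times\mathbb{Z}$.
   Context: Fix a positive odd integer $d=2j+1$. For a real symmetric positive definite $2\times2$ matrix $\sigma$, the Gaussian function of two discrete variables is $$\mathbf{g}_\sigma(n_1,n_2)=\sum_{\alpha_1,\alpha_2=-\infty}^{\infty}\exp\left(-\frac{\pi}{d}\,(n_1+\alpha_1 d,\; n_2+\alpha_2 d)\,\sigma\begin{pmatrix} n_1+\alpha_1 d\\ n_2+\alpha_2 d\end{pmatrix}\right),\qquad (n_1,n_2)\in\mathbb{Z}\times\mathbb{Z}.$$ For $\psi:\mathbb{Z}\times\mathbb{Z}\to\mathbb{C}$ that is $d$-periodic in each variable, the discrete Fourier transform is $$\mathbf{F}[\psi](k_1,k_2)=\frac1d\sum_{n_1=-j}^{j}\sum_{n_2=-j}^{j}e^{-\frac{2\pi \mathrm{i}}{d}(k_1n_1+k_2n_2)}\,\psi(n_1,n_2),\qquad (k_1,k_2)\in\mathbb{Z}\times\mathbb{Z}.$$ *)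

(* Defs.v *)
From mathcomp Require Import all_boot all_order all_algebra.
From mathcomp Require Import complex.
From mathcomp Require Import ring lra zify.
From mathcomp Require Import all_classical all_reals all_analysis.

Set Implicit Arguments.
Unset Strict Implicit.
Unset Printing Implicit Defensive.

Import Order.TTheory GRing.Theory Num.Theory.
Import numFieldNormedType.Exports.

Local Open Scope classical_set_scope.
Local Open Scope ring_scope.

Definition qform (R : realType) (sigma : 'M[R]_2) (v : 'rV[R]_2) : R :=
  (v *m sigma *m v^T) 0 0.

Definition posdef (R : realType) (sigma : 'M[R]_2) : Prop :=
  forall v : 'rV[R]_2, v != 0 -> 0 < qform sigma v.

Definition int_row (R : realType) (m : int * int) : 'rV[R]_2 :=
  \row_(i < 2) (if i == 0 then m.1 else m.2)%:~R.

Definition translate (d : nat) (n alpha : int * int) : int * int :=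
  (n.1 + alpha.1 * d%:Z, n.2 + alpha.2 * d%:Z).

Definition gaussian_term (R : realType) (d : nat) (sigma : 'M[R]_2)
    (n alpha : int * int) : R :=
  expR (- (pi / d%:R) * qform sigma (int_row R (translate d n alpha))).

(* The terms are positive, so the unordered sum [\esum] is the double series;
   it is finite by [gaussian_summable], so [fine] loses nothing. *)
Definition gaussian (R : realType) (d : nat) (sigma : 'M[R]_2)
    (n : int * int) : R :=
  fine (\esum_(alpha in [set: int * int]) (gaussian_term d sigma n alpha)%:E).

(* exp (i t) *)
Definition expi (R : realType) (t : R) : R[i] := (cos t +i* sin t)%C.

(* The index m running over 0, ..., 2j stands for m - j in -j, ..., j. *)
Definition dft (R : realType) (j : nat) (psi : int * int -> R[i])
    (k : int * int) : R[i] :=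
  let d := (2 * j + 1)%N in
  d%:R^-1 *
  \sum_(0 <= m1 < d) \sum_(0 <= m2 < d)
    let n := (m1%:Z - j%:Z, m2%:Z - j%:Z) in
    expi (- (2 * pi / d%:R) * (k.1 * n.1 + k.2 * n.2)%:~R) * psi n.

Lemma qformE (R : realType) (sigma : 'M[R]_2) (v : 'rV[R]_2) :
  sigma \is symmetricmx ->
  qform sigma v = sigma 0 0 * v 0 0 ^+ 2 + 2 * sigma 0 1 * v 0 0 * v 0 1
                  + sigma 1 1 * v 0 1 ^+ 2.
Proof.
rewrite qualifE /= expr0 scale1r map_mx_id // => /eqP sym.
have s10 : sigma 1 0 = sigma 0 1 by rewrite {1}sym mxE.
have two (F : 'I_2 -> R) : \sum_i F i = F 0 + F 1.
  rewrite !big_ord_recl big_ord0 addr0; congr (F _ + F _).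
  exact: val_inj.
by rewrite /qform mxE two !mxE !two s10; ring.
Qed.

Lemma qform_coercive (R : realType) (sigma : 'M[R]_2) :
  sigma \is symmetricmx -> posdef sigma ->
  exists2 lambda : R, 0 < lambda &
    forall v : 'rV[R]_2, lambda * (v 0 0 ^+ 2 + v 0 1 ^+ 2) <= qform sigma v.
Proof.
move=> sym pos.
set a := sigma 0 0; set b := sigma 0 1; set c := sigma 1 1.
pose w (x y : R) : 'rV[R]_2 := \row_(i < 2) if i == 0 then x else y.
have wP x y : (x != 0) || (y != 0) ->
    0 < a * x ^+ 2 + 2 * b * x * y + c * y ^+ 2.
  move=> xy; have /pos : w x y != 0.
    apply: contraTneq xy => /rowP w0.
    move: (w0 0) (w0 1); rewrite !mxE /= => -> ->.
    by rewrite eqxx.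
  by rewrite qformE // !mxE.
have a0 : 0 < a by have := wP 1 0; rewrite oner_eq0 => /(_ isT); nra.
have c0 : 0 < c by have := wP 0 1; rewrite oner_eq0 orbT => /(_ isT); nra.
have D0 : 0 < a * c - b ^+ 2.
  have := wP (- b) a; rewrite (gt_eqF a0) orbT => /(_ isT).
  rewrite (_ : _ + _ = a * (a * c - b ^+ 2)); last by ring.
  by rewrite pmulr_rgt0.
have ac0 : 0 < a + c by exact: addr_gt0.
exists ((a * c - b ^+ 2) / (a + c)); first exact: divr_gt0.
move=> v; rewrite qformE // -/a -/b -/c.
set x := v 0 0; set y := v 0 1.
rewrite mulrAC ler_pdivrMr // -subr_ge0.
rewrite (_ : _ - _ = (a * x + b * y) ^+ 2 + (b * x + c * y) ^+ 2); last by ring.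
by rewrite addr_ge0 ?sqr_ge0.
Qed.

Lemma summable_geometric2 (R : realType) (f : int * int -> R) (K r : R) :
  0 <= r < 1 -> 0 <= K ->
  (forall m, 0 <= f m <= K * (r ^+ `|m.1|%N * r ^+ `|m.2|%N)) ->
  summable [set: int * int] (fun m => (f m)%:E).
Proof.
move=> /andP[r0 r1] K0 fK; rewrite /summable.
pose S : R := 2 / (1 - r).
have S0 : 0 <= S by rewrite divr_ge0 // subr_ge0 ltW.
apply: (@le_lt_trans _ _ (K * (S * S))%:E); last exact: ltry.
apply: ge_ereal_sup => _ [A [finA _] <-].
rewrite fsbig_finite //=.
under eq_bigr => m _ do rewrite ger0_norm ?(andP (fK m)).1 //.
rewrite sumEFin lee_fin.
set s : seq (int * int) := finmap.enum_fset _.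
have us : uniq s by exact: finmap.fset_uniq.
have [N sN] : exists N, {in s, forall m, maxn `|m.1| `|m.2| < N}%N.
  exists (\max_(m <- s) maxn `|m.1| `|m.2|).+1 => m ms.
  by rewrite ltnS; exact: (@leq_bigmax_seq _ _ xpredT (fun m => maxn `|m.1| `|m.2|)).
pose B := [seq Posz i | i <- iota 0 N] ++ [seq Negz i | i <- iota 0 N].
have mB (x : int) : (`|x| < N)%N -> x \in B.
  case: x => i /=; rewrite mem_cat => iN; apply/orP; [left|right].
    by apply: map_f; rewrite mem_iota.
  by apply: map_f; rewrite mem_iota /= add0n (leq_trans _ iN) // leqnSn.
have uB : uniq B.
  rewrite cat_uniq !map_inj_uniq ?iota_uniq ?andbT /=; try by move=> ? ? [].
  by apply/hasPn => _ /mapP[i _ ->]; apply/negP => /mapP[].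
have sB : {subset s <= [seq (x, y) | x <- B, y <- B]}.
  move=> [x y] /sN /=; rewrite gtn_max => /andP[xN yN].
  by apply/allpairsP; exists (x, y); split => //=; exact: mB.
have geoB : \sum_(x <- B) r ^+ `|x|%N <= S.
  have geo : \sum_(0 <= i < N) r ^+ i <= (1 - r)^-1.
    rewrite big_mkord -[leRHS]mul1r ler_pdivlMr ?subr_gt0 //.
    have := subrX1 r N; have := exprn_ge0 N r0.
    by move: (\sum_(i < N) r ^+ i) (r ^+ N) => s1 s2 h1 h2; nra.
  rewrite big_cat !big_map /= /S mulr_natl mulr2n lerD //.
    by rewrite -[N]subn0.
  apply: le_trans geo; rewrite -{1}[N]subn0 -/(index_iota 0 N).
  by apply: ler_sum => i _; rewrite ler_wiXn2l ?(ltW r1) //= leqnSn.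
pose g (m : int * int) : R := K * (r ^+ `|m.1|%N * r ^+ `|m.2|%N).
have g0 m : 0 <= g m by rewrite /g !mulr_ge0 ?exprn_ge0.
apply: (@le_trans _ _ (\sum_(m <- s) g m)).
  by apply: ler_sum => m _; exact: (andP (fK m)).2.
apply: (@le_trans _ _ (\sum_(m <- [seq (x, y) | x <- B, y <- B]) g m)).
  rewrite [leRHS](bigID (mem s)) /= -[leLHS]addr0 lerD ?sumr_ge0 //.
  rewrite -[leRHS]big_filter le_eqVlt; apply/orP; left; apply/eqP.
  apply: perm_big; apply: uniq_perm => //.
    rewrite filter_uniq // allpairs_uniq //.
    by move=> [? ?] [? ?] _ _ [-> ->].
  move=> m; rewrite mem_filter /=.
  by case ms : (m \in s); rewrite //= sB.
rewrite big_allpairs /g /=.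
under eq_bigr => x _ do rewrite -mulr_sumr -mulr_sumr.
rewrite -mulr_sumr -mulr_suml ler_wpM2l //.
by rewrite ler_pM // sumr_ge0 // => x _; rewrite exprn_ge0.
Qed.

Lemma gaussian_summable (R : realType) (d : nat) (sigma : 'M[R]_2)
    (n : int * int) :
  (0 < d)%N -> sigma \is symmetricmx -> posdef sigma ->
  summable [set: int * int] (fun alpha => (gaussian_term d sigma n alpha)%:E).
Proof.
move=> d0 sym pos; have [l l0 lP] := qform_coercive sym pos.
have dR : 0 < d%:R :> R by rewrite ltr0n.
pose mu := pi / d%:R * l.
have mu0 : 0 < mu by rewrite mulr_gt0 // divr_gt0 // pi_gt0.
pose r := expR (- mu).
have r0 : 0 < r := expR_gt0 _.
have r1 : r < 1 by rewrite -expR0 ltr_expR oppr_lt0.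
pose K := r ^- `|n.1|%N * r ^- `|n.2|%N.
apply: (@summable_geometric2 _ _ K r).
- by rewrite (ltW r0).
- by rewrite mulr_ge0 // invr_ge0 exprn_ge0 // ltW.
move=> al; rewrite /gaussian_term expR_ge0 /=.
have bnd (m e : int) : r ^+ (`|(m + e * d%:Z)%R| ^ 2)%N <= r ^- `|m|%N * r ^+ `|e|%N.
  rewrite [leRHS]mulrC ler_pdivlMr ?exprn_gt0 // -exprD.
  apply: ler_wiXn2l; [exact: ltW|exact: ltW|].
  have h1 : (`|e| <= `|(e * d%:Z)%R|)%N by rewrite abszM leq_pmulr.
  have h2 : (`|(m + e * d%:Z)%R| <= `|(m + e * d%:Z)%R| ^ 2)%N.
    by case: (absz _) => // k; rewrite leq_pmulr.
  lia.
rewrite (_ : K * _ = (r ^- `|n.1|%N * r ^+ `|al.1|%N) *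
                     (r ^- `|n.2|%N * r ^+ `|al.2|%N)); last by rewrite mulrACA.
apply: le_trans (ler_pM _ _ (bnd _ _) (bnd _ _)); rewrite ?exprn_ge0 ?(ltW r0) //.
rewrite -exprD /r -expRM_natr ler_expR mulNr mulNr lerN2.
have := lP (int_row R (translate d n al)); rewrite !mxE /= => lv.
have sq (z : int) : z%:~R ^+ 2 = (`|z| ^ 2)%:R :> R.
  by rewrite natrX natr_absz intr_norm real_normK ?num_real.
rewrite !sq in lv.
rewrite natrD /mu -[leLHS]mulrA ler_pM2l ?divr_gt0 ?pi_gt0 //.
Qed.

Lemma gaussian_periodic (R : realType) (d : nat) (sigma : 'M[R]_2)
    (n m : int * int) :
  gaussian d sigma (translate d n m) = gaussian d sigma n.
Proof.
rewrite /gaussian; congr fine.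
rewrite [RHS](@reindex_esum _ _ _ setT setT
  (fun al : int * int => (m.1 + al.1, m.2 + al.2))).
  apply: eq_esum => al _; rewrite /gaussian_term /translate /=.
  by rewrite !mulrDl !addrA.
split=> [al _ //| [x y] [x' y'] _ _ [/addrI -> /addrI ->] //| [x y] _ /=].
by exists (x - m.1, y - m.2) => //=; rewrite ![_ + (_ - _)]addrC !subrK.
Qed.

(* Main.v *)
(* Completing the square, the quadratic form is a (x + b y / a)^2 + (det / a) y^2, so
   the sum over the whole lattice splits into two one-variable sums; each is
   transformed by theta inversion
     sum_n exp (- pi t (n + x)^2) e^(-2 i pi n k / d)
       = t^(-1/2) sum_n exp (- pi (n + k/d)^2 / t) e^(2 i pi (n + k/d) x),
   the second time read from right to left with k = 0.  Theta inversion itself is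
   obtained by Polya's method, without Fourier analysis: expanding
   (2 cos (pi (x + i) / l))^(2 m) e^(-2 i pi i k / d) by the binomial theorem and summing over
   i mod l, with d | l, keeps only the binomial coefficients C(2 m, m + l (b + k/d)).
   When l and m tend to infinity with m / l^2 tending to t / pi, the powers of cosines and the
   normalised binomial coefficients both tend to Gaussians, and dominated
   convergence of series applies on both sides. *)

Require Import Defs.
From mathcomp Require Import all_boot all_order all_algebra.
From mathcomp Require Import complex.
From mathcomp Require Import ring lra zify.
From mathcomp Require Import all_classical all_reals all_analysis.

Import Order.TTheory GRing.Theory Num.Theory.
Import numFieldNormedType.Exports.
Local Open Scope classical_set_scope.
Local Open Scope ring_scope.

Set Implicit Arguments.
Unset Strict Implicit.
Unset Printing Implicit Defensive.

(** * Absolutely convergent sums *)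

(** [fine] sends an infinite sum to 0, so the value is meaningful only under [has_nsum]. *)
Definition nsum (R : realType) (T : choiceType) (p : T -> R) : R :=
  fine (\esum_(x in [set: T]) (p x)%:E).

Definition has_nsum (R : realType) (T : choiceType) (p : T -> R) : Prop :=
  (forall x, 0 <= p x) /\ (\esum_(x in [set: T]) (p x)%:E < +oo)%E.

Lemma nsumK (R : realType) (T : choiceType) (p : T -> R) :
  has_nsum p -> (nsum p)%:E = (\esum_(x in [set: T]) (p x)%:E)%E.
Proof.
move=> [p0 pfin]; rewrite /nsum fineK // fin_num_abs gee0_abs //.
by apply: esum_ge0 => x _; rewrite lee_fin.
Qed.

Lemma nsum_ge0 (R : realType) (T : choiceType) (p : T -> R) :
  (forall x, 0 <= p x) -> 0 <= nsum p.
Proof. by move=> p0; apply/fine_ge0/esum_ge0 => x _; rewrite lee_fin. Qed.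

Lemma has_nsum_le (R : realType) (T : choiceType) (p q : T -> R) :
  has_nsum q -> (forall x, 0 <= p x <= q x) -> has_nsum p.
Proof.
move=> [q0 qfin] pq; split=> [x|]; first by case/andP: (pq x).
by apply: le_lt_trans qfin; apply: le_esum => x _; rewrite lee_fin; case/andP: (pq x).
Qed.

Lemma le_nsum (R : realType) (T : choiceType) (p q : T -> R) :
  has_nsum q -> (forall x, 0 <= p x <= q x) -> nsum p <= nsum q.
Proof.
move=> hq pq; rewrite -lee_fin !nsumK //; last exact: has_nsum_le pq.
by apply: le_esum => x _; rewrite lee_fin; case/andP: (pq x).
Qed.

Lemma has_nsumD (R : realType) (T : choiceType) (p q : T -> R) :
  has_nsum p -> has_nsum q -> has_nsum (fun x => p x + q x).
Proof.
move=> [p0 pfin] [q0 qfin]; split=> [x|]; first exact: addr_ge0.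
under eq_esum do rewrite EFinD.
by rewrite esumD ?lte_add_pinfty // => x _; rewrite lee_fin.
Qed.

Lemma nsumD (R : realType) (T : choiceType) (p q : T -> R) :
  has_nsum p -> has_nsum q -> nsum (fun x => p x + q x) = nsum p + nsum q.
Proof.
move=> hp hq; apply: EFin_inj; rewrite nsumK; last exact: has_nsumD.
rewrite EFinD !nsumK //; under eq_esum do rewrite EFinD.
by rewrite esumD // => x _; rewrite lee_fin; [case: hp|case: hq].
Qed.

(** One inequality is proved on finite partial sums; the other is the same inequality for the factor
    [c^-1] and the family [c * p x]. *)
Lemma esumZ (R : realType) (T : choiceType) (c : R) (p : T -> R) :
  0 < c -> (forall x, 0 <= p x) ->
  (\esum_(x in [set: T]) (c * p x)%:E = c%:E * \esum_(x in [set: T]) (p x)%:E)%E.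
Proof.
have le (b : R) (f : T -> R) : 0 < b -> (forall x, 0 <= f x) ->
    (\esum_(x in [set: T]) (b * f x)%:E <=
     b%:E * \esum_(x in [set: T]) (f x)%:E)%E.
  move=> b0 f0; apply: ge_ereal_sup => _ [X [finX _] <-].
  under eq_fsbigr do rewrite EFinM.
  rewrite -ge0_mule_fsumr; last by move=> x; rewrite lee_fin.
  apply: lee_wpmul2l; first by rewrite lee_fin ltW.
  by apply: ereal_sup_ubound; exists X.
move=> c0 p0; apply/eqP; rewrite eq_le le //=.
rewrite -lee_pdivlMl //; apply: le_trans (le _ _ _ _); rewrite ?invr_gt0 //.
  by apply: le_esum => x _; rewrite lee_fin mulKf ?gt_eqF.
by move=> x; rewrite mulr_ge0 // ltW.
Qed.

Lemma has_nsumZ (R : realType) (T : choiceType) (c : R) (p : T -> R) :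
  0 <= c -> has_nsum p -> has_nsum (fun x => c * p x).
Proof.
rewrite le_eqVlt => /predU1P[<-|c0] [p0 pfin]; split=> [x|].
- by rewrite mul0r.
- by rewrite esum1 // => x _; rewrite mul0r.
- by rewrite mulr_ge0 // ltW.
- by rewrite esumZ // lte_mul_pinfty // lee_fin ltW.
Qed.

Lemma nsumZ (R : realType) (T : choiceType) (c : R) (p : T -> R) :
  0 <= c -> has_nsum p -> nsum (fun x => c * p x) = c * nsum p.
Proof.
move=> c0 hp; apply: EFin_inj; rewrite nsumK; last exact: has_nsumZ.
move: c0; rewrite le_eqVlt => /predU1P[<-|c0].
  by rewrite mul0r esum1 // => x _; rewrite mul0r.
by rewrite esumZ //; [rewrite EFinM nsumK | case: hp].
Qed.

(* Meaningful only when [fun x => `|f x|] has a finite sum. *)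
Definition ssum (R : realType) (T : choiceType) (f : T -> R) : R :=
  nsum (fun x => `|f x| + f x) - nsum (fun x => `|f x|).

Lemma eq_ssum (R : realType) (T : choiceType) (f g : T -> R) :
  f =1 g -> ssum f = ssum g.
Proof. by move=> /funext ->. Qed.

Lemma normrD_ge0 (R : realType) (x : R) : 0 <= `|x| + x.
Proof. by rewrite addrC -lerBlDr sub0r lerNnormlW. Qed.

Lemma has_nsum_normD (R : realType) (T : choiceType) (f : T -> R) :
  has_nsum (fun x => `|f x|) -> has_nsum (fun x => `|f x| + f x).
Proof.
move=> hf; apply: has_nsum_le (has_nsumD hf hf) _ => x.
by rewrite normrD_ge0 lerD2l ler_norm.
Qed.

(** Termwise [(|f| + f) + q = p + |f|], so every splitting of [f] into summable nonnegative parts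
    has the same difference of sums. Linearity of [ssum] then amounts to choosing a splitting. *)
Lemma ssumE (R : realType) (T : choiceType) (f p q : T -> R) :
  has_nsum p -> has_nsum q -> (forall x, f x = p x - q x) ->
  ssum f = nsum p - nsum q.
Proof.
move=> hp hq fE.
have hf : has_nsum (fun x => `|f x|).
  apply: has_nsum_le (has_nsumD hp hq) _ => x; rewrite normr_ge0 fE.
  by apply: le_trans (ler_normB _ _) _; rewrite !ger0_norm //; [case: hq|case: hp].
apply/eqP; rewrite subr_eq addrAC eq_sym subr_eq -!nsumD //.
- by apply/eqP; congr nsum; apply/funext => x; rewrite fE addrC addrA subrK addrC.
- exact: has_nsum_normD.
Qed.

Lemma ssum_nsum (R : realType) (T : choiceType) (f : T -> R) :
  has_nsum f -> ssum f = nsum f.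
Proof.
move=> hf; have h0 : has_nsum (fun _ : T => 0 : R).
  by split=> //; rewrite esum1.
rewrite (ssumE hf h0) => [|x]; last by rewrite subr0.
by rewrite /(nsum (fun=> 0)) esum1 // subr0.
Qed.

Lemma ssumB (R : realType) (T : choiceType) (f g : T -> R) :
  has_nsum (fun x => `|f x|) -> has_nsum (fun x => `|g x|) ->
  ssum (fun x => f x - g x) = ssum f - ssum g.
Proof.
move=> hf hg; have hf' := has_nsum_normD hf; have hg' := has_nsum_normD hg.
rewrite (@ssumE _ _ (fun x => f x - g x) _ _ (has_nsumD hf' hg) (has_nsumD hg' hf)) => [|x /=]; last by ring.
by rewrite (nsumD hf' hg) (nsumD hg' hf) /ssum; ring.
Qed.

Lemma ssumZ (R : realType) (T : choiceType) (c : R) (f : T -> R) :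
  has_nsum (fun x => `|f x|) -> ssum (fun x => c * f x) = c * ssum f.
Proof.
move=> hf; have hf' := has_nsum_normD hf.
have [c0|/ltW c0] := leP 0 c.
  rewrite (@ssumE _ _ (fun x => c * f x) _ _ (has_nsumZ c0 hf') (has_nsumZ c0 hf)) => [|x /=]; last by ring.
  by rewrite (nsumZ c0 hf') (nsumZ c0 hf) /ssum mulrBr.
have {}c0 : 0 <= - c by rewrite oppr_ge0.
rewrite (@ssumE _ _ (fun x => c * f x) _ _ (has_nsumZ c0 hf) (has_nsumZ c0 hf')) => [|x /=]; last by ring.
by rewrite (nsumZ c0 hf') (nsumZ c0 hf) /ssum; ring.
Qed.

Lemma ler_norm_ssum (R : realType) (T : choiceType) (f : T -> R) :
  has_nsum (fun x => `|f x|) -> `|ssum f| <= nsum (fun x => `|f x|).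
Proof.
move=> hf; rewrite ler_norml /ssum lerBrDr addNr nsum_ge0 /=; last first.
  by move=> x; exact: normrD_ge0.
rewrite lerBlDr -nsumD //; apply: le_nsum => [|x]; first exact: has_nsumD.
by rewrite normrD_ge0 lerD2l ler_norm.
Qed.

Lemma reindex_ssum (R : realType) (T T' : choiceType) (e : T -> T')
    (f : T' -> R) :
  injective e -> (forall y, ~ range e y -> f y = 0) -> ssum f = ssum (f \o e).
Proof.
move=> inj fe.
(* Both sums in the definition of [ssum] have terms [h (f x)] with [h 0 = 0]. *)
have E (h : R -> R) : h 0 = 0 -> nsum (h \o f) = nsum (h \o f \o e).
  move=> h0; congr fine.
  rewrite -(@esum_image _ _ _ setT e (fun y => (h (f y))%:E)); last first.
    by move=> x y _ _ /inj.
  rewrite [RHS]esum_mkcond; apply: eq_esum => y _; case: ifPn => //.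
  by rewrite notin_setE /= => /fe ->; rewrite h0.
congr (_ - _); first by apply: (E (fun y => `|y| + y)); rewrite normr0 addr0.
by apply: (E (fun y => `|y|)); rewrite normr0.
Qed.

Lemma has_nsum_comp (R : realType) (T T' : choiceType) (e : T -> T')
    (p : T' -> R) :
  injective e -> has_nsum p -> has_nsum (p \o e).
Proof.
move=> inj [p0 pfin]; split=> [x|]; first exact: p0.
apply: le_lt_trans pfin.
rewrite -(@esum_image _ _ _ setT e (fun z => (p z)%:E)); last first.
  by move=> x y _ _ /inj.
rewrite esum_mkcond; apply: le_esum => z _.
by case: ifP => _; rewrite lee_fin.
Qed.

Lemma has_nsum_row (R : realType) (T1 T2 : choiceType) (p : T1 * T2 -> R) i :
  has_nsum p -> has_nsum (fun j => p (i, j)).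
Proof. by apply: has_nsum_comp => x y []. Qed.

(** Tonelli's theorem; Fubini for [ssum] follows by applying it to [|f| + f] and to [|f|]. *)
Lemma nsum_pair (R : realType) (T1 T2 : choiceType) (p : T1 * T2 -> R) :
  has_nsum p ->
  has_nsum (fun i => nsum (fun j => p (i, j))) /\
  nsum (fun i => nsum (fun j => p (i, j))) = nsum p.
Proof.
move=> hp; have [p0 pfin] := hp.
have E : (\esum_(i in [set: T1]) (nsum (fun j => p (i, j)))%:E =
          \esum_(z in [set: T1 * T2]) (p z)%:E)%E.
  under eq_esum => i _ do rewrite (nsumK (has_nsum_row i hp)).
  rewrite (esum_esum (a := fun i j => (p (i, j))%:E)); last first.
    by move=> i j _ _; rewrite lee_fin p0.
  rewrite (_ : _ `*`` _ = setT); last by apply/seteqP; split.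
  by apply: eq_esum => -[].
split; first by split=> [i|]; [exact: nsum_ge0 | rewrite E].
by rewrite {1}/nsum E.
Qed.

Lemma ssum_pair (R : realType) (T1 T2 : choiceType) (f : T1 * T2 -> R) :
  has_nsum (fun z => `|f z|) ->
  ssum f = ssum (fun i => ssum (fun j => f (i, j))).
Proof.
move=> hf; have hf' := has_nsum_normD hf.
have [h1 e1] := nsum_pair hf; have [h2 e2] := nsum_pair hf'.
by rewrite [RHS](ssumE h2 h1) // e1 e2.
Qed.

Lemma has_nsum_ssum (R : realType) (T1 T2 : choiceType) (f : T1 * T2 -> R) :
  has_nsum (fun z => `|f z|) ->
  has_nsum (fun i => `|ssum (fun j => f (i, j))|).
Proof.
move=> hf; have [h _] := nsum_pair hf; apply: has_nsum_le h _ => i.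
by rewrite normr_ge0 ler_norm_ssum //; exact: has_nsum_row i hf.
Qed.

Lemma ssum_exchange (R : realType) (T1 T2 : choiceType) (f : T1 -> T2 -> R) :
  has_nsum (fun z => `|f z.1 z.2|) ->
  ssum (fun i => ssum (f i)) = ssum (fun j => ssum (f^~ j)).
Proof.
move=> hf; rewrite -(@ssum_pair _ _ _ (fun z => f z.1 z.2)) //.
rewrite (@reindex_ssum _ _ _ (fun z : T2 * T1 => (z.2, z.1))); last 2 first.
- by move=> [? ?] [? ?] [-> ->].
- by move=> [x y] []; exists (y, x).
rewrite ssum_pair //=.
apply: (@has_nsum_comp _ _ _ (fun z : T2 * T1 => (z.2, z.1)) _ _ hf).
by move=> [? ?] [? ?] [-> ->].
Qed.

Lemma has_nsumM (R : realType) (T1 T2 : choiceType) (u : T1 -> R) (v : T2 -> R) :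
  has_nsum u -> has_nsum v -> has_nsum (fun z => u z.1 * v z.2).
Proof.
move=> hu hv; have [u0 ufin] := hu; have [v0 vfin] := hv.
split=> [z|]; first exact: mulr_ge0.
rewrite -(_ : setT `*`` (fun=> setT) = setT); last by apply/seteqP; split.
rewrite -(esum_esum (a := fun i j => (u i * v j)%:E)); last first.
  by move=> i j _ _; rewrite lee_fin mulr_ge0.
under eq_esum => i _ do
  rewrite -(nsumK (has_nsumZ (u0 i) hv)) nsumZ // mulrC.
by have [] := has_nsumZ (nsum_ge0 v0) hu.
Qed.

Lemma nsum_seq (R : realType) (T : choiceType) (s : seq T) (p : T -> R) :
  uniq s -> (forall x, 0 <= p x) -> (forall x, x \notin s -> p x = 0) ->
  has_nsum p /\ nsum p = \sum_(x <- s) p x.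
Proof.
move=> us p0 ps.
have E : (\esum_(x in [set: T]) (p x)%:E = (\sum_(x <- s) p x)%:E)%E.
  rewrite (_ : \esum_(x in _) _ = \esum_(x in [set` s]) (p x)%:E).
    rewrite esum_fset //; last by move=> *; rewrite lee_fin.
    by rewrite -fsbig_seq // sumEFin.
  rewrite [RHS]esum_mkcond; apply: eq_esum => x _; case: ifPn => //.
  by rewrite notin_setE /= => /negP/ps ->.
by rewrite /has_nsum /nsum E ltry.
Qed.

Lemma ssum_seq (R : realType) (T : choiceType) (s : seq T) (f : T -> R) :
  uniq s -> (forall x, x \notin s -> f x = 0) ->
  has_nsum (fun x => `|f x|) /\ ssum f = \sum_(x <- s) f x.
Proof.
move=> us fs.
have [h e] := @nsum_seq R T s (fun x => `|f x|) us
  (fun=> normr_ge0 _) (fun x xs => etrans (congr1 _ (fs x xs)) (normr0 _)).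
split=> //; rewrite /ssum e.
have [|x xs|_ ->] := @nsum_seq R T s (fun x => `|f x| + f x) us.
- by move=> x; exact: normrD_ge0.
- by rewrite fs // normr0 addr0.
- by rewrite -sumrB; apply: eq_bigr => x _; rewrite addrAC subrr add0r.
Qed.

Lemma ssum_fin (R : realType) (T : finType) (f : T -> R) :
  ssum f = \sum_x f x.
Proof.
have [|_ ->] := @ssum_seq R T (enum T) f (enum_uniq _); last by rewrite big_enum.
by move=> x; rewrite mem_enum.
Qed.

(** Dominated convergence: a finite set [s] carries the sum of [u + u], a bound for [|f n - g|], up
    to [e / 2], and the finite sum of the differences over [s] tends to 0. *)
Lemma tannery (R : realType) (T : choiceType) (f : nat -> T -> R) (g u : T -> R) :
  has_nsum u -> (forall n x, `|f n x| <= u x) ->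
  (forall x, f n x @[n --> \oo] --> g x) ->
  ssum (f n) @[n --> \oo] --> ssum g.
Proof.
move=> hu fu fg; have [u0 ufin] := hu.
have gu x : `|g x| <= u x.
  have h : `|f n x| @[n --> \oo] --> `|g x| by apply: cvg_norm; exact: fg.
  rewrite -(cvg_lim _ h) //.
  apply: limr_le; first by apply/cvg_ex; exists `|g x|.
  by apply: nearW => n; exact: fu.
have hd n : has_nsum (fun x => `|f n x - g x|).
  apply: has_nsum_le (has_nsumD hu hu) _ => x; rewrite normr_ge0.
  by apply: le_trans (ler_normB _ _) _; exact: lerD.
have hfn n : has_nsum (fun x => `|f n x|).
  by apply: has_nsum_le hu _ => x; rewrite normr_ge0 fu.
have hg : has_nsum (fun x => `|g x|).
  by apply: has_nsum_le hu _ => x; rewrite normr_ge0 gu.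
apply/cvgrPdist_le => e e0.
pose v x := u x + u x.
have hv : has_nsum v := has_nsumD hu hu.
have [v0 vfin] := hv.
have [A [finA _] Av] : exists2 A, fsets setT A &
    ((nsum v)%:E - (e / 2)%:E < \sum_(x \in A) (v x)%:E)%E.
  have : ((nsum v)%:E - (e / 2)%:E < \esum_(x in setT) (v x)%:E)%E.
    by rewrite -nsumK // -EFinB lte_fin ltrBlDr ltrDl divr_gt0.
  by move=> /ereal_sup_gt[_ [A fA <-]] lt; exists A.
have [s us As] : exists2 s : seq T, uniq s & A = [set` s].
  have /finite_seqP[s sA] := finA.
  exists (undup s); first exact: undup_uniq.
  by rewrite sA; apply/seteqP; split=> x /=; rewrite mem_undup.
rewrite As -fsbig_seq // sumEFin -EFinB lte_fin in Av.
have tail n : nsum (fun x => `|f n x - g x|) <=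
    \sum_(x <- s) `|f n x - g x| + e / 2.
  (* [chi] is the indicator of [s]; it splits a sum into its part on [s] and its tail. *)
  pose chi x : R := (x \in s)%:R.
  pose w (p : T -> R) x := chi x * p x.
  have wp p : (forall x, 0 <= p x) -> has_nsum (w p) /\ nsum (w p) = \sum_(x <- s) p x.
    move=> p0; have [x|x xs|h ->] := @nsum_seq R T s (w p) us.
    - by rewrite /w mulr_ge0 // ler0n.
    - by rewrite /w /chi (negbTE xs) mul0r.
    - split=> //; rewrite big_seq [RHS]big_seq; apply: eq_bigr => x xs.
      by rewrite /w /chi xs mul1r.
  have [hwv wv] := wp _ v0.
  have [hwd wd] := wp (fun x => `|f n x - g x|) (fun=> normr_ge0 _).
  have hle : forall x, 0 <= (1 - chi x) * v x.
    by move=> x; rewrite mulr_ge0 // /chi subr_ge0 lern1 leq_b1.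
  have hvc : has_nsum (fun x => (1 - chi x) * v x).
    apply: has_nsum_le hv _ => x; rewrite hle /=.
    by rewrite mulrBl mul1r gerBl mulr_ge0 // ler0n.
  have vE : nsum v = \sum_(x <- s) v x + nsum (fun x => (1 - chi x) * v x).
    rewrite -wv -nsumD //; congr nsum; apply/funext => x; rewrite /w; ring.
  have hlast : nsum (fun x => (1 - chi x) * v x) <= e / 2.
    by move: Av; rewrite vE; lra.
  apply: le_trans (lerD (lexx _) hlast).
  rewrite -wd -nsumD //; apply: le_nsum; first exact: has_nsumD.
  move=> x; rewrite normr_ge0 /= /w /chi.
  case: (x \in s); first by rewrite mul1r subrr mul0r addr0.
  rewrite mul0r subr0 mul1r add0r /v.
  by apply: le_trans (ler_normB _ _) _; exact: lerD.
have S0 : \sum_(x <- s) `|f n x - g x| @[n --> \oo] --> (0 : R).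
  suff : \sum_(x <- s) `|f n x - g x| @[n --> \oo] --> \sum_(x <- s) `|g x - g x|.
    by rewrite [X in _ --> X]big1 // => x _; rewrite subrr normr0.
  elim: s {us As Av tail} => [|x s ih].
    by under eq_fun do rewrite big_nil; rewrite big_nil; exact: cvg_cst.
  under eq_fun do rewrite big_cons; rewrite big_cons; apply: cvgD => //.
  by apply: cvg_norm; apply: cvgB; [exact: fg|exact: cvg_cst].
have e2 : 0 < e / 2 by rewrite divr_gt0.
have /cvgrPdist_le/(_ _ e2) := S0.
apply: filterS => n; rewrite sub0r normrN => Sn.
rewrite distrC -ssumB //; apply: le_trans (ler_norm_ssum (hd n)) _.
apply: le_trans (tail n) _; move: Sn => /(le_trans (ler_norm _)); lra.
Qed.

(** * Polya's finite identity *)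

Lemma cosDint (R : realType) (a : R) (z : int) :
  cos (a + 2 * pi * z%:~R) = cos a.
Proof.
have P (n : nat) (b : R) : cos (b + 2 * pi * n%:R) = cos b.
  have -> : 2 * pi * n%:R = pi *+ 2 *+ n :> R by rewrite mulr_natr mulr_natl.
  exact: periodicn (@cosD2pi R) n b.
case: z => n; first exact: P.
by rewrite NegzE mulrNz mulrN -[LHS](P n.+1) subrK.
Qed.

(** Real part of the binomial expansion of [(e^(iu) + e^(-iu))^n e^(-iv)]. The induction uses [2 cos
    u cos v = cos (v - u) + cos (v + u)] and Pascal's rule. *)
Lemma mul2cos_exp (R : realType) (n : nat) (u v : R) :
  (2 * cos u) ^+ n * cos v =
  \sum_(r < n.+1) 'C(n, r)%:R * cos ((2 * r%:R - n%:R) * u - v).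
Proof.
elim: n v => [|n ih] v.
  by rewrite big_ord1 expr0 mul1r bin0 mul1r mulr0 subrr mul0r sub0r cosN.
have -> : (2 * cos u) ^+ n.+1 * cos v =
    (2 * cos u) ^+ n * cos (v - u) + (2 * cos u) ^+ n * cos (v + u).
  by rewrite exprSr cosB cosD; ring.
rewrite !ih; pose c r : R := cos ((2 * r%:R - n.+1%:R) * u - v).
have -> : \sum_(r < n.+1) 'C(n, r)%:R * cos ((2 * r%:R - n%:R) * u - (v - u)) =
    \sum_(r < n.+1) 'C(n, r)%:R * c r.+1.
  apply: eq_bigr => r _; congr (_ * cos _).
  by rewrite -!natr1; ring.
have -> : \sum_(r < n.+1) 'C(n, r)%:R * cos ((2 * r%:R - n%:R) * u - (v + u)) =
    \sum_(r < n.+1) 'C(n, r)%:R * c r.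
  apply: eq_bigr => r _; congr (_ * cos _).
  by rewrite -!natr1; ring.
rewrite [RHS]big_ord_recl /= bin0.
under [in RHS]eq_bigr => i _ do rewrite /= /bump /= add1n binS natrD mulrDl.
rewrite big_split /= addrA [RHS]addrC; congr (_ + _).
have -> : \sum_(r < n.+1) 'C(n, r)%:R * c r = \sum_(r < n.+2) 'C(n, r)%:R * c r.
  by rewrite [RHS]big_ord_recr /= bin_small // mul0r addr0.
by rewrite big_ord_recl /= bin0.
Qed.

(** The remainder [p] of [q] mod [l] satisfies [0 < pi p / l < pi], and adding a multiple of [pi]
    changes the sine at most by a sign. *)
Lemma sin_pi_neq0 (R : realType) (l : nat) (q : int) :
  (0 < l)%N -> ~~ (l %| q)%Z -> sin (pi * q%:~R / l%:R) != 0 :> R.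
Proof.
move=> l0 lq; have lR : (0 : R) < l%:R by rewrite ltr0n.
have lZ : (l%:Z != 0)%R by rewrite eqz_nat -lt0n.
set p := (q %% l)%Z.
have p0 : 0 < p.
  rewrite lt_neqAle modz_ge0 // andbT eq_sym.
  by apply: contra lq => /eqP h; apply/dvdz_mod0P.
have pl : p < l by rewrite ltz_pmod.
have s0 : 0 < sin (pi * p%:~R / l%:R) :> R.
  apply: sin_gt0_pi; rewrite divr_gt0 //=; last by rewrite mulr_gt0 ?pi_gt0 ?ltr0z.
  rewrite ltr_pdivrMr // ltr_pM2l ?pi_gt0 //.
  by rewrite -[l%:R]/(l%:Z%:~R) ltr_int.
have -> : pi * q%:~R / l%:R = pi * p%:~R / l%:R + pi * (q %/ l)%Z%:~R :> R.
  rewrite {1}(divz_eq q l) rmorphD rmorphM /= -[l%:Z%:~R]/(l%:R).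
  by field; rewrite gt_eqF.
have sinpiz (z : int) : sin (pi * z%:~R) = 0 :> R.
  have sinn (n : nat) : sin (pi * n%:R) = 0 :> R.
    by have := alternatingn (@sinDpi R) n 0; rewrite add0r sin0 mulr0 mulr_natr.
  case: z => n; first exact: sinn.
  by rewrite NegzE mulrNz mulrN sinN sinn oppr0.
have cospiz (z : int) : cos (pi * z%:~R) != 0 :> R.
  by rewrite -normr_eq0 sin0cos1 ?sinpiz ?oner_eq0.
by rewrite sinD sinpiz mulr0 addr0 mulf_neq0 // gt_eqF.
Qed.

(** Orthogonality of characters mod [l] in real form. If [l] does not divide [q], multiplication by
    [2 sin h] makes the sum telescope, and the end angles differ by [2 l h = 2 pi q]. *)
Lemma sum_cos_arith (R : realType) (l : nat) (q : int) (B : R) :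
  (0 < l)%N ->
  \sum_(i < l) cos (B + i%:R * (2 * pi * q%:~R / l%:R)) =
  if (l %| q)%Z then l%:R * cos B else 0.
Proof.
move=> l0; have lR : (0 : R) < l%:R by rewrite ltr0n.
pose h : R := pi * q%:~R / l%:R.
case: ifPn => lq.
  have /dvdzP[z zE] := lq.
  rewrite (eq_bigr (fun _ => cos B)); last first.
    move=> i _; rewrite -[RHS](cosDint _ (i%:Z * z)) zE; congr (cos (_ + _)).
    rewrite !rmorphM /= -[l%:Z%:~R]/(l%:R) -[i%:Z%:~R]/(i%:R).
    by field; rewrite gt_eqF.
  by rewrite sumr_const card_ord mulr_natl.
have s0 : sin h != 0 := sin_pi_neq0 R l0 lq.
have s2 : 2 * sin h != 0 by rewrite mulf_neq0 ?pnatr_eq0.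
apply: (mulfI s2); rewrite mulr0 mulr_sumr.
pose S (i : nat) : R := sin (B + (2 * i%:R - 1) * h).
rewrite (eq_bigr (fun i : 'I_l => S i.+1 - S i)); last first.
  move=> i _; rewrite /S.
  have -> : B + (2 * i.+1%:R - 1) * h = (B + i%:R * (2 * h)) + h.
    by rewrite -natr1; ring.
  have -> : B + (2 * i%:R - 1) * h = (B + i%:R * (2 * h)) - h by ring.
  rewrite (_ : 2 * pi * _ / _ = 2 * h) ?/h; last by rewrite !mulrA.
  by rewrite sinD sinB; ring.
rewrite -(big_mkord xpredT (fun i => S i.+1 - S i)) telescope_sumr //.
apply/eqP; rewrite subr_eq0; apply/eqP; rewrite /S.
(* Sines become cosines shifted by [pi / 2], so that [cosDint] applies. *)
rewrite -[sin (B + (2 * 0 - 1) * h)]cosBpihalf.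
rewrite -(cosDint _ q) -cosBpihalf; congr cos.
by rewrite /h; field; rewrite gt_eqF.
Qed.

(** After expansion of the cosine power and exchange of the sums, the inner angles form an
    arithmetic progression of step [2 pi (r - m - K) / l], which selects [r - m = K] mod [l]. *)
Lemma polya_identity (R : realType) (l m : nat) (s K : int) (x w : R) :
  (0 < l)%N ->
  \sum_(i < l) (2 * cos (pi * (x + (s + i%:Z)%:~R) / l%:R)) ^+ (2 * m) *
     cos (2 * pi * ((s + i%:Z)%:~R * (K%:~R / l%:R) + w)) =
  \sum_(r < (2 * m).+1) 'C(2 * m, r)%:R *
     (if (l %| r%:Z - m%:Z - K)%Z
      then l%:R * cos (2 * pi * ((r%:Z - m%:Z)%:~R * x / l%:R - w)) else 0).
Proof.
move=> l0; have lR : (0 : R) < l%:R by rewrite ltr0n.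
under eq_bigr do rewrite mul2cos_exp.
rewrite exchange_big /=; apply: eq_bigr => r _.
rewrite -mulr_sumr; congr (_ * _).
pose q := r%:Z - m%:Z - K.
pose B : R := 2 * pi * ((r%:Z - m%:Z)%:~R * x / l%:R - w) + s%:~R * (2 * pi * q%:~R / l%:R).
rewrite (eq_bigr (fun i : 'I_l => cos (B + i%:R * (2 * pi * q%:~R / l%:R)))); last first.
  move=> i _; congr cos; rewrite /B /q natrM !rmorphB rmorphD /=.
  rewrite -[i%:Z%:~R]/(i%:R) -[r%:Z%:~R]/(r%:R) -[m%:Z%:~R]/(m%:R).
  by field; rewrite gt_eqF.
(* When [l] divides [q], the part of [B] that contains [s] is an integer multiple of [2 pi]. *)
rewrite sum_cos_arith // -/q; case: ifP => // /dvdzP[z zE].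
congr (_ * _); rewrite -[RHS](cosDint _ (s * z)); congr cos.
rewrite /B zE !rmorphM /= -[l%:Z%:~R]/(l%:R).
by field; rewrite gt_eqF.
Qed.

(* By symmetry this is C(2 m, m + z) for [z] of either sign; it is 0 when [`|z| > m]. *)
Definition midbin (m : nat) (z : int) : nat := 'C(2 * m, m + `|z|).

(** The surviving indices are [r - m = K + b l]; since [midbin] vanishes beyond [m], the sum over
    them extends to all integers [b]. The factor [4^m] comes from [(2 cos)^(2 m)]. *)
Lemma polya_ssum (R : realType) (l m : nat) (s K : int) (x w : R) :
  (0 < l)%N ->
  \sum_(i < l) cos (pi * (x + (s + i%:Z)%:~R) / l%:R) ^+ (2 * m) *
     cos (2 * pi * ((s + i%:Z)%:~R * (K%:~R / l%:R) + w)) =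
  ssum (fun b : int => l%:R / 4 ^+ m * (midbin m (K + b * l%:Z))%:R *
      cos (2 * pi * ((K + b * l%:Z)%:~R * x / l%:R - w))).
Proof.
move=> l0; have lR : (0 : R) < l%:R by rewrite ltr0n.
pose G (z : int) : R := if (l %| z - K)%Z then l%:R / 4 ^+ m * (midbin m z)%:R *
   cos (2 * pi * (z%:~R * x / l%:R - w)) else 0.
transitivity (ssum G); last first.
  rewrite (@reindex_ssum _ _ _ (fun b : int => K + b * l%:Z)).
  - apply: eq_ssum => b /=; rewrite /G.
    by rewrite addrAC subrr add0r dvdz_mull.
  - by move=> a b /addrI /mulIf; apply; rewrite eqz_nat -lt0n.
  - move=> y yK; rewrite /G; case: ifP => // /dvdzP[b yb].
    by case: yK; exists b => //; rewrite -yb addrC subrK.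
pose sq := [seq r%:Z - m%:Z | r <- iota 0 (2 * m).+1].
have [|z|_ ->] := @ssum_seq R int sq G.
- by rewrite map_inj_uniq ?iota_uniq // => a b /addIr [].
- move=> zs; rewrite /G /midbin bin_small ?mulr0 ?mul0r; first by case: ifP.
  rewrite mul2n -addnn ltn_add2l ltnNge; apply: contra zs => zm.
  apply/mapP; exists (absz (z + m%:Z)); last by lia.
  by rewrite mem_iota; lia.
rewrite big_map -[iota _ _]/(index_iota 0 (2 * m).+1) big_mkord.
have f0 : 4 ^+ m != 0 :> R by rewrite expf_neq0 // pnatr_eq0.
apply: (mulfI f0); rewrite !mulr_sumr.
have E (c : R) : 4 ^+ m * c ^+ (2 * m) = (2 * c) ^+ (2 * m).
  by rewrite (_ : 4 = 2 ^+ 2) -?exprM -?exprMn // -natrX.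
under eq_bigr do rewrite (mulrA (4 ^+ m)) E.
rewrite polya_identity //; apply: eq_bigr => r _; rewrite /G; case: ifP => _; last by rewrite !mulr0.
rewrite /midbin (_ : 'C(_, m + _) = 'C(2 * m, r)); first by field.
have [mr|rm] := leqP m r; first by congr 'C(_, _); lia.
rewrite -[RHS]bin_sub; last by lia.
by congr 'C(_, _); lia.
Qed.

(** * Estimates for the two sides *)

(** By the mean value theorem [sin u = u cos c] with [c] between 0 and [u], hence
    [cos u <= cos c <= 1] for [u > 0]. *)
Lemma sqr_sin_bounds (R : realType) (u : R) : `|u| <= pi / 2 ->
  u ^+ 2 * cos u ^+ 2 <= sin u ^+ 2 <= u ^+ 2.
Proof.
wlog u0 : u / 0 <= u.
  move=> H hu; have [u0|/ltW u0] := leP 0 u; first exact: H.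
  have := H (- u); rewrite oppr_ge0 normrN sinN cosN !sqrrN; exact.
rewrite ger0_norm // => u2.
move: u0; rewrite le_eqVlt => /predU1P[<-|u0].
  by rewrite sin0 !expr2 !mul0r lexx.
have [c /[!in_itv] /= /andP[c0 cu]] : exists2 c, c \in `]0, u[ &
    sin u - sin 0 = cos c * (u - 0).
  by apply: MVT => //; apply: continuous_subspaceT => x; exact: continuous_sin.
have pi0 := pi_gt0 R.
have cosu : 0 <= cos u by apply: cos_ge0_pihalf; apply/andP; split; lra.
have cosc : cos u <= cos c.
  by apply/ltW; rewrite ltr_cos // in_itv /=; apply/andP; split; lra.
rewrite sin0 !subr0 => ->; rewrite exprMn mulrC.
have c2 : cos c ^+ 2 <= 1 by rewrite expr_le1 ?cos_le1 // (le_trans cosu).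
rewrite ler_wpM2r ?sqr_ge0 ?lerXn2r ?nnegrE ?(le_trans cosu) //=.
by rewrite ler_piMl ?sqr_ge0.
Qed.

(** Halving the angle: [sin u = 2 sin (u/2) cos (u/2)], where [cos (u/2)^2 >= 1/2] because
    [cos u >= 0], and [sin (u/2)] is bounded below by [sqr_sin_bounds]. *)
Lemma sqr_sin_ge (R : realType) (u : R) : `|u| <= pi / 2 ->
  u ^+ 2 / 4 <= sin u ^+ 2.
Proof.
move=> hu; have pi0 := pi_gt0 R.
have cosu : 0 <= cos u by apply: cos_ge0_pihalf; rewrite -ler_norml.
have hu2 : `|u / 2| <= pi / 2.
  by rewrite normrM normfV (ger0_norm (ler0n _ 2)); lra.
have /andP[h _] := sqr_sin_bounds hu2.
have uE : u = (u / 2) *+ 2 by rewrite -mulr_natr divfK // pnatr_eq0.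
have su : sin u = cos (u / 2) * sin (u / 2) * 2.
  by rewrite {1}uE sin_mulr2n mulr_natr.
have cu : cos u = cos (u / 2) ^+ 2 *+ 2 - 1 by rewrite {1}uE cos_mulr2n.
have {cu cosu} c2 : 1 / 2 <= cos (u / 2) ^+ 2 by move: cosu; rewrite cu -mulr_natr; lra.
rewrite su !exprMn.
apply: le_trans (_ : cos (u / 2) ^+ 2 * ((u / 2) ^+ 2 * cos (u / 2) ^+ 2) * 2 ^+ 2 <= _).
  have -> : (u / 2) ^+ 2 = u ^+ 2 / 4 by field.
  move: c2 (sqr_ge0 u); move: (cos _ ^+ 2) (u ^+ 2) => c v c2 v0.
  have : 1 / 4 <= c * c by nra.
  by move=> cc; nra.
by rewrite ler_wpM2r ?sqr_ge0 // ler_wpM2l // sqr_ge0.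
Qed.

(** Both bounds are [1 + x <= expR x]: at [x = - a], and at [x = a / (1 - a)], where [1 + x] is the
    inverse of [1 - a]. *)
Lemma expR_le_onem_exp (R : realType) (a : R) (n : nat) : 0 <= a < 1 ->
  expR (- (n%:R * (a / (1 - a)))) <= (1 - a) ^+ n <= expR (- (n%:R * a)).
Proof.
move=> /andP[a0 a1]; have b0 : 0 < 1 - a by rewrite subr_gt0.
rewrite -[- (n%:R * a)]mulrN -[- (n%:R * _)]mulrN !expRM_natl; apply/andP; split.
  rewrite lerXn2r ?nnegrE ?expR_ge0 ?(ltW b0) // expRN.
  rewrite -[leRHS]invrK lef_pV2 ?posrE ?expR_gt0 ?invr_gt0 //.
  apply: le_trans (expR_ge1Dx _); rewrite le_eqVlt; apply/orP; left; apply/eqP.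
  by field; rewrite gt_eqF.
rewrite lerXn2r ?nnegrE ?expR_ge0 ?(ltW b0) //; exact: expR_ge1Dx.
Qed.

Lemma cvg_expRN (R : realType) (a : R^nat) (L : R) :
  a @ \oo --> L -> expR (- a n) @[n --> \oo] --> expR (- L).
Proof.
by move=> aL; apply: continuous_cvg; [exact: continuous_expR | exact: cvgN].
Qed.

(** The two exponents in [expR_le_onem_exp] differ by the factor [1 / (1 - a n)], which tends to
    1. *)
Lemma cvg_onem_exp (R : realType) (a : R^nat) (M : nat^nat) (L : R) :
  (forall n, 0 <= a n < 1) -> a @ \oo --> (0 : R) ->
  (M n)%:R * a n @[n --> \oo] --> L ->
  (1 - a n) ^+ M n @[n --> \oo] --> expR (- L).
Proof.
move=> a01 a0 Ma.
apply: (@squeeze_cvgr _ _ _ _ (fun n => expR (- ((M n)%:R * (a n / (1 - a n)))))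
  (fun n => expR (- ((M n)%:R * a n)))).
- by apply: nearW => n; exact: expR_le_onem_exp.
- apply: cvg_expRN; under eq_fun do rewrite mulrA.
  have h : (M n)%:R * a n * (1 - a n)^-1 @[n --> \oo] --> L * (1 - 0)^-1.
    apply: cvgM => //; apply: cvgV; first by rewrite subr0 oner_eq0.
    by apply: cvgB => //; exact: cvg_cst.
  by rewrite subr0 invr1 mulr1 in h.
- exact: cvg_expRN.
Qed.

(* The ratio of the two binomials is the product over [i < |z|] of
   [1 - |z| / (m + |z| - i)]. *)
Lemma midbin_bounds (R : realType) (m : nat) (z : int) :
  [/\ (midbin m z)%:R <= 'C(2 * m, m)%:R * expR (- (z%:~R ^+ 2 / (m + `|z|)%:R)) :> R
    & (`|z| < m)%N -> 'C(2 * m, m)%:R * expR (- (z%:~R ^+ 2 / (m - `|z|)%:R)) <= (midbin m z)%:R :> R].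
Proof.
have -> : z%:~R ^+ 2 = `|z|%N%:R ^+ 2 :> R by rewrite natr_absz intr_norm real_normK ?num_real.
rewrite /midbin; move: `|z|%N => k.
have [mk|km] := ltnP m k.
  split; last by rewrite ltnNge (ltnW mk).
  by rewrite bin_small ?mulr_ge0 ?expR_ge0 ?ler0n // mul2n -addnn ltn_add2l.
(* Both sides equal [(2 m)! / (m! (m - k)!)]. *)
have key : ('C(2 * m, m + k) * (m + k) ^_ k = 'C(2 * m, m) * m ^_ k)%N.
  have h1 := @bin_fact (2 * m) (m + k); have h2 := @bin_fact (2 * m) m.
  have h3 := @ffact_fact (m + k) k; have h4 := @ffact_fact m k.
  rewrite (_ : 2 * m - (m + k) = m - k)%N in h1; last by lia.
  rewrite (_ : 2 * m - m = m)%N in h2; last by lia.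
  rewrite addnK in h3.
  have := h1 ltac:(lia); have := h2 ltac:(lia); have := h3 ltac:(lia); have := h4 ltac:(lia).
  move=> {h1 h2 h3 h4} h4 h3 h2 h1.
  apply/eqP; rewrite -(eqn_pmul2r (fact_gt0 m)) -(eqn_pmul2r (fact_gt0 (m - k))).
  apply/eqP; rewrite -!mulnA (mulnA (_ ^_ _) m`!) h3 h1 -h2.
  by rewrite (mulnCA (m ^_ k)) h4.
have Q (n : nat) : (n ^_ k)%:R = \prod_(i < k) (n - i)%:R :> R.
  by rewrite ffact_prod natr_prod.
have pos : (0 : R) < \prod_(i < k) (m + k - i)%:R.
  by apply: prodr_gt0 => i _; rewrite ltr0n; have := ltn_ord i; lia.
have rho : 'C(2 * m, m + k)%:R =
    'C(2 * m, m)%:R * \prod_(i < k) (1 - k%:R / (m + k - i)%:R) :> R.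
  apply: (mulIf (lt0r_neq0 pos)).
  rewrite -Q -natrM key natrM -mulrA; congr (_ * _).
  rewrite !Q -big_split /=; apply: eq_bigr => i _.
  have ik := ltn_ord i.
  have p0 : ((m + k - i)%:R : R) != 0 by rewrite pnatr_eq0; lia.
  rewrite mulrBl mul1r divfK // -natrB; last by lia.
  by congr (_%:R); lia.
have C0 : (0 : R) < 'C(2 * m, m)%:R by rewrite ltr0n bin_gt0; lia.
rewrite rho !ler_pM2l //.
have kk (c : R) : k%:R ^+ 2 / c = k%:R * (k%:R / c) by rewrite mulrA expr2.
split.
  case: (posnP k) => [->|k0].
    by rewrite big_ord0 expr0n mul0r oppr0 expR0.
  rewrite kk -mulrN expRM_natl -[X in expR _ ^+ X]card_ord -prodr_const.
  apply: ler_prod => i _; have ik := ltn_ord i.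
  have p0 : (0 : R) < (m + k - i)%:R by rewrite ltr0n; lia.
  have p1 : (0 : R) < (m + k)%:R by rewrite ltr0n; lia.
  apply/andP; split.
    by rewrite subr_ge0 ler_pdivrMr // mul1r ler_nat; lia.
  apply: le_trans (expR_ge1Dx _); rewrite lerD2l lerN2 ler_wpM2l ?ler0n //.
  by rewrite lef_pV2 ?posrE // ler_nat; lia.
move=> km'; rewrite kk -mulrN expRM_natl -[X in expR _ ^+ X]card_ord -prodr_const.
apply: ler_prod => i _; have ik := ltn_ord i.
have p0 : (0 : R) < (m + k - i)%:R by rewrite ltr0n; lia.
have p1 : (0 : R) < (m - k)%:R by rewrite ltr0n; lia.
rewrite expR_ge0 /=.
(* Here [a / (1 - a) = k / (m - i)], which is at most [k / (m - k)]. *)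
set a := k%:R / (m + k - i)%:R.
have a01 : 0 <= a < 1.
  by rewrite /a divr_ge0 ?ler0n //= ltr_pdivrMr // mul1r ltr_nat; lia.
have /andP[h _] := expR_le_onem_exp 1 a01.
rewrite expr1 mul1r in h; apply: le_trans h.
rewrite ler_expR lerN2.
have -> : a / (1 - a) = k%:R / (m - i)%:R.
  have -> : (m - i)%:R = (m + k - i)%:R - k%:R :> R by rewrite -natrB; [congr _%:R|]; lia.
  have : (m + k - i)%:R - k%:R != 0 :> R by rewrite -natrB ?pnatr_eq0; lia.
  move=> h; rewrite /a; field; rewrite h /=.
  by rewrite gt_eqF.
rewrite ler_wpM2l ?ler0n // lef_pV2 ?posrE ?ler_nat ?ltr0n //; lia.
Qed.

(* Its limit is [2 / pi] (Wallis), but only its existence is needed: the constant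
   is identified at the end by self-duality of [sum exp (- pi n^2)]. *)
Definition wallis (R : realType) (m : nat) : R :=
  (2 * m + 1)%:R * ('C(2 * m, m)%:R / 4 ^+ m) ^+ 2.

(** The sequence is nonnegative and the ratio of consecutive terms is
    [(2m + 1)(2m + 3) / (2m + 2)^2 < 1]. *)
Lemma cvg_wallis (R : realType) : cvgn (@wallis R).
Proof.
apply: nonincreasing_is_cvgn; last first.
  by exists 0 => _ [m _ <-]; rewrite /wallis mulr_ge0 ?sqr_ge0 ?ler0n.
apply/nonincreasing_seqP => m; rewrite /wallis.
have rec : (m.+1%:R : R) * 'C(2 * m.+1, m.+1)%:R = 2 * (2 * m + 1)%:R * 'C(2 * m, m)%:R.
  have h1 := mul_bin_diag (2 * m).+2 m; have h2 := mul_bin_down (2 * m).+1 m.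
  rewrite [(_ - m)%N](_ : _ = m.+1) /= in h2; last by lia.
  rewrite -!natrM (_ : 2 * m.+1 = (2 * m).+2)%N; last by lia.
  by congr _%:R; rewrite -h1 -mulnA addn1 h2 mulnA; congr (_ * _)%N; lia.
have m0 : (m.+1%:R : R) != 0 by rewrite pnatr_eq0.
have -> : 'C(2 * m.+1, m.+1)%:R = 2 * (2 * m + 1)%:R / m.+1%:R * 'C(2 * m, m)%:R :> R.
  by apply: (mulfI m0); rewrite rec; field.
have p4 : (4 ^+ m : R) != 0 by rewrite expf_neq0 // pnatr_eq0.
rewrite (_ : _ / 4 ^+ m.+1 = (2 * m + 1)%:R / (2 * m.+1%:R) * ('C(2 * m, m)%:R / 4 ^+ m)); last first.
  rewrite exprS; field; rewrite p4 //= ; exact: m0.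
rewrite exprMn mulrA ler_wpM2r ?sqr_ge0 //.
have M0 := ler0n R m.
rewrite !natrD !natrM -!natr1 exprMn exprVn mulrA ler_pdivrMr ?exprn_gt0 //; nra.
Qed.

(* [l] sampling points and exponent [2 M], with [M ~ tau l^2]. *)
Record polya_scale (R : realType) (tau : R) (l M : nat^nat) : Prop := PolyaScale {
  scale_gt0 : 0 < tau;
  scale_l_gt0 : forall n, (0 < l n)%N;
  scale_l_cvg : (l n)%:R^-1 @[n --> \oo] --> (0 : R);
  scale_ge : forall n, tau * (l n)%:R ^+ 2 <= (M n)%:R;
  scale_le : forall n, (M n)%:R <= tau * (l n)%:R ^+ 2 + 1 }.

(** Multiples of [d] are taken for [l] so that [k / d] is a fraction with denominator [l n]. *)
Lemma polya_scale_exists (R : realType) (tau : R) (d : nat) :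
  0 < tau -> (0 < d)%N ->
  exists M, polya_scale tau (fun n => d * n.+1)%N M.
Proof.
move=> t0 d0; exists (fun n => (Num.truncn (tau * (d * n.+1)%:R ^+ 2)).+1).
split=> // [n||n|n].
- by rewrite muln_gt0 d0.
- have -> : (fun n => (d * n.+1)%:R^-1) = (fun n => d%:R^-1 * harmonic n) :> (nat -> R).
    by apply/funext => n; rewrite natrM invfM.
  by rewrite -(mulr0 d%:R^-1); apply: cvgMl_tmp; exact: cvg_harmonic.
- exact/ltW/truncnS_gt.
- by rewrite -natr1 lerD2r truncn_le mulr_ge0 ?sqr_ge0 // ltW.
Qed.

Lemma cvg_scale_ratio (R : realType) (tau : R) (l M : nat^nat) :
  polya_scale tau l M -> (M n)%:R / (l n)%:R ^+ 2 @[n --> \oo] --> tau.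
Proof.
move=> [t0 l0 lc Mge Mle].
apply: (@squeeze_cvgr _ _ _ _ (fun=> tau) (fun n => tau + (l n)%:R^-1 * (l n)%:R^-1)).
- apply: nearW => n; have l2 : (0 : R) < (l n)%:R ^+ 2 by rewrite exprn_gt0 ?ltr0n.
  rewrite ler_pdivlMr // Mge /= ler_pdivrMr // (le_trans (Mle n)) // mulrDl lerD2l.
  by rewrite -expr2 exprVn mulVf // gt_eqF.
- exact: cvg_cst.
- rewrite -[X in _ --> X](addr0 tau); apply: cvgD; first exact: cvg_cst.
  by rewrite -(mulr0 0); apply: cvgM.
Qed.

(** The power is [(1 - sin^2 u)^M], and [M sin^2 u] has the same limit as [M u^2] because [u] tends
    to 0. *)
Lemma cvg_cos_pow (R : realType) (tau : R) (l M : nat^nat) (y : R) :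
  polya_scale tau l M ->
  cos (pi * y / (l n)%:R) ^+ (2 * M n) @[n --> \oo] --> expR (- (pi ^+ 2 * tau * y ^+ 2)).
Proof.
move=> H; have [t0 l0 lc Mge Mle] := H; have cM := cvg_scale_ratio H.
pose u n := pi * y / (l n)%:R.
have u0 : u n @[n --> \oo] --> (0 : R).
  by rewrite -(mulr0 (pi * y)); apply: cvgMl_tmp.
have cosu : cos (u n) @[n --> \oo] --> (1 : R).
  by rewrite -[X in _ --> X]cos0; apply: continuous_cvg => //; exact: continuous_cos.
have Mu : (M n)%:R * u n ^+ 2 @[n --> \oo] --> pi ^+ 2 * tau * y ^+ 2.
  have -> : (fun n => (M n)%:R * u n ^+ 2) =
      (fun n => (pi * y) ^+ 2 * ((M n)%:R / (l n)%:R ^+ 2)).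
    by apply/funext => n; rewrite /u expr_div_n; ring.
  have -> : pi ^+ 2 * tau * y ^+ 2 = (pi * y) ^+ 2 * tau by ring.
  exact: cvgMl_tmp.
have small : \forall n \near \oo, `|u n| <= pi / 2.
  have p2 : 0 < pi / 2 :> R by rewrite divr_gt0 ?pi_gt0.
  have /cvgrPdist_le/(_ _ p2) := u0.
  by apply: filterS => n; rewrite sub0r normrN.
have sinu : (M n)%:R * sin (u n) ^+ 2 @[n --> \oo] --> pi ^+ 2 * tau * y ^+ 2.
  apply: (@squeeze_cvgr _ _ _ _ (fun n => (M n)%:R * u n ^+ 2 * (cos (u n) * cos (u n)))
    (fun n => (M n)%:R * u n ^+ 2)) => //.
    apply: filterS small => n /sqr_sin_bounds/andP[h1 h2].
    by rewrite -mulrA ler_wpM2l ?ler0n -?expr2 //= ler_wpM2l.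
  rewrite -[X in _ --> X]mulr1 -[in X in _ --> X](mulr1 1).
  by apply: cvgM => //; apply: cvgM.
have sin0' : sin (u n) ^+ 2 @[n --> \oo] --> (0 : R).
  rewrite (_ : 0 = sin 0 * sin 0 :> R); last by rewrite sin0 mul0r.
  under eq_fun do rewrite expr2.
  by apply: cvgM; apply: continuous_cvg => //; exact: continuous_sin.
have [N _ HN] : \forall n \near \oo, sin (u n) ^+ 2 < 1.
  have /cvgrPdist_lt/(_ 1 ltr01) := sin0'.
  by apply: filterS => n; rewrite sub0r normrN ger0_norm ?sqr_ge0.
(* [cvg_onem_exp] wants [sin^2 < 1] at every index, which holds from [N] on. *)
rewrite -(cvg_shiftn N).
under eq_fun => n do rewrite exprM cos2sin2.
apply: (@cvg_onem_exp _ (fun n => sin (u (n + N)%N) ^+ 2) (fun n => M (n + N)%N)).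
- by move=> n; rewrite sqr_ge0 /=; apply: HN; rewrite /= leq_addl.
- by rewrite (cvg_shiftn N (fun n => sin (u n) ^+ 2)).
- by rewrite (cvg_shiftn N (fun n => (M n)%:R * sin (u n) ^+ 2)).
Qed.

(** Domination uniform in [n]: the bound on [y] keeps the angle within [pi / 2], where [sqr_sin_ge]
    applies and costs the factor 4. *)
Lemma cos_pow_le (R : realType) (tau : R) (l M : nat^nat) (y : R) n :
  polya_scale tau l M -> `|y| <= (l n)%:R / 2 ->
  0 <= cos (pi * y / (l n)%:R) ^+ (2 * M n) <= expR (- (pi ^+ 2 * tau / 4 * y ^+ 2)).
Proof.
move=> [t0 l0 _ Mge _] yl; have lR : (0 : R) < (l n)%:R by rewrite ltr0n.
rewrite exprM exprn_ge0 ?sqr_ge0 //= cos2sin2.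
set u := pi * y / (l n)%:R.
have hu : `|u| <= pi / 2.
  rewrite /u !normrM normfV (gtr0_norm lR) (gtr0_norm (pi_gt0 R)) -mulrA.
  by rewrite ler_pM2l ?pi_gt0 // ler_pdivrMr // mulrC.
have sl := sqr_sin_ge hu.
(* If the squared sine is 1, the power is 0 since [M n > 0]; the exponential bound does not cover
   this case. *)
have [s1|s1] := eqVneq (sin u ^+ 2) 1.
  rewrite s1 subrr; case: (posnP (M n)) => [M0|M0].
    have := Mge n; rewrite M0 leNgt => /negP[].
    by rewrite mulr_gt0 ?exprn_gt0.
  by rewrite expr0n gtn_eqF // expR_ge0.
have s01 : 0 <= sin u ^+ 2 < 1.
  rewrite sqr_ge0 /= lt_neqAle s1 /= -[leRHS](cos2Dsin2 u) lerDr; exact: sqr_ge0.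
have /andP[_ h] := expR_le_onem_exp (M n) s01; apply: le_trans h _.
rewrite ler_expR lerN2; apply: le_trans (ler_pM _ _ (Mge n) sl).
- rewrite /u le_eqVlt; apply/orP; left; apply/eqP; field; exact: lt0r_neq0.
- by rewrite mulr_ge0 ?sqr_ge0 // ltW.
- by rewrite divr_ge0 ?sqr_ge0.
Qed.

(** With [|z| = l |y|], the exponents [z^2 / (M + |z|)] and [z^2 / (M - |z|)] of [midbin_bounds]
    become [y^2 / (M / l^2 + e |y| / l)] with [e = 1] and [e = -1]. *)
Lemma cvg_midbin (R : realType) (tau y : R) (l M : nat^nat) (z : nat -> int) :
  polya_scale tau l M -> (forall n, (z n)%:~R = (l n)%:R * y) ->
  (midbin (M n) (z n))%:R / 'C(2 * M n, M n)%:R @[n --> \oo] -->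
    expR (- (y ^+ 2 / tau)).
Proof.
move=> H zl; have [t0 l0 lc Mge Mle] := H; have cM := cvg_scale_ratio H.
have C0 n : (0 : R) < 'C(2 * M n, M n)%:R by rewrite ltr0n bin_gt0; lia.
have zR n : `|z n|%N%:R = (l n)%:R * `|y|.
  by rewrite natr_absz intr_norm zl normrM (ger0_norm (ler0n _ _)).
have lR n : (l n)%:R != 0 :> R by rewrite pnatr_eq0 -lt0n.
have aux (e : R) : y ^+ 2 / ((M n)%:R / (l n)%:R ^+ 2 + e * (`|y| * (l n)%:R^-1))
    @[n --> \oo] --> y ^+ 2 / tau.
  apply: cvgMl_tmp; apply: cvgV; first by rewrite gt_eqF.
  rewrite -[X in _ --> X]addr0; apply: cvgD => //.
  rewrite -(mulr0 e); apply: cvgMl_tmp; rewrite -(mulr0 `|y|); exact: cvgMl_tmp.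
(* Once [|y| / l < tau], one has [|z| = l |y| < tau l^2 <= M]. *)
have zM : \forall n \near \oo, (`|z n| < M n)%N.
  have : `|y| * (l n)%:R^-1 @[n --> \oo] --> (0 : R).
    by rewrite -(mulr0 `|y|); apply: cvgMl_tmp.
  move=> /cvgrPdist_lt/(_ _ t0); apply: filterS => n; rewrite sub0r normrN.
  move=> /(le_lt_trans (ler_norm _)) h; rewrite -(ltr_nat R) zR.
  apply: lt_le_trans (Mge n); rewrite expr2 mulrA mulrC ltr_pM2r ?ltr0n //.
  by rewrite -ltr_pdivrMr // ltr0n.
apply: (@squeeze_cvgr _ _ _ _
  (fun n => expR (- (y ^+ 2 / ((M n)%:R / (l n)%:R ^+ 2 + (-1) * (`|y| * (l n)%:R^-1)))))
  (fun n => expR (- (y ^+ 2 / ((M n)%:R / (l n)%:R ^+ 2 + 1 * (`|y| * (l n)%:R^-1)))))).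
- apply: filterS zM => n zMn.
  have [up lo] := midbin_bounds R (M n) (z n); have {}lo := lo zMn.
  rewrite ler_pdivlMr // [X in X <= _]mulrC ler_pdivrMr // [X in _ && (_ <= X)]mulrC.
  have m1 : (M n)%:R - (l n)%:R * `|y| != 0.
    by rewrite -zR -natrB ?(ltnW zMn) // pnatr_eq0 -lt0n subn_gt0.
  have m2 : (M n)%:R + (l n)%:R * `|y| != 0.
    by rewrite -zR -natrD pnatr_eq0; lia.
  apply/andP; split.
    apply: le_trans lo; rewrite natrB ?(ltnW zMn) // zR zl.
    rewrite le_eqVlt; apply/orP; left; apply/eqP; congr (_ * expR (- _)).
    by field; rewrite m1 lR.
  apply: (le_trans up); rewrite natrD zR zl.
  rewrite le_eqVlt; apply/orP; left; apply/eqP; congr (_ * expR (- _)).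
  by field; rewrite lR mulrC m2.
- by apply: cvg_expRN; exact: aux.
- by apply: cvg_expRN; exact: aux.
Qed.

(** For [|z| <= M], [M + |z| <= 2 M <= 2 (tau + 1) l^2] since [l >= 1]; for larger [|z|] the
    binomial is 0. *)
Lemma midbin_le (R : realType) (tau y : R) (l M : nat^nat) (z : int) n :
  polya_scale tau l M -> z%:~R = (l n)%:R * y ->
  (0 : R) <= (midbin (M n) z)%:R / 'C(2 * M n, M n)%:R <=
    expR (- ((2 * (tau + 1))^-1 * y ^+ 2)).
Proof.
move=> [t0 l0 _ Mge Mle] zl.
have C0 : (0 : R) < 'C(2 * M n, M n)%:R by rewrite ltr0n bin_gt0; lia.
rewrite divr_ge0 ?ler0n //= ler_pdivrMr // mulrC.
have [Mz|zM] := ltnP (M n) `|z|.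
  by rewrite /midbin bin_small ?mulr_ge0 ?expR_ge0 // mul2n -addnn ltn_add2l.
have [up _] := midbin_bounds R (M n) z; apply: (le_trans up).
rewrite ler_pM2l // ler_expR lerN2 mulrC zl exprMn.
have l2 : (1 : R) <= (l n)%:R ^+ 2 by rewrite -natrX ler1n expn_gt0 l0.
have M0 : (0 : R) < (M n)%:R by apply: lt_le_trans (Mge n); rewrite mulr_gt0 // (lt_le_trans ltr01).
have N0 : (0 : R) < (M n + `|z|)%:R by move: M0; rewrite !ltr0n; lia.
rewrite [leRHS]mulrAC [leLHS]mulrC ler_wpM2r ?sqr_ge0 //.
rewrite -[leLHS]invrK -[leRHS]invrK lef_pV2 ?posrE ?invr_gt0 ?invrK //.
- rewrite invfM invrK ler_pdivrMl ?(lt_le_trans ltr01) //.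
  apply: (@le_trans _ _ (2 * (M n)%:R)).
    by rewrite -natrM ler_nat; lia.
  have := Mle n; move: ((l n)%:R ^+ 2) l2 => L L1 ML; lra.
- by rewrite mulr_gt0 // addr_gt0.
- by rewrite divr_gt0 // (lt_le_trans ltr01).
Qed.

(** The square of the coefficient is [wallis M] divided by [(2 M + 1) / l^2], whose limit is
    [2 tau]. *)
Lemma cvg_scale_coef (R : realType) (tau : R) (l M : nat^nat) :
  polya_scale tau l M ->
  (l n)%:R / 4 ^+ M n * 'C(2 * M n, M n)%:R @[n --> \oo] -->
    Num.sqrt (limn (@wallis R) / (2 * tau)).
Proof.
move=> H; have [t0 l0 lc Mge Mle] := H; have cM := cvg_scale_ratio H.
have lR n : (l n)%:R != 0 :> R by rewrite pnatr_eq0 -lt0n.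
have p4 n : (4 ^+ M n : R) != 0 by rewrite expf_neq0 // pnatr_eq0.
have -> : (fun n => (l n)%:R / 4 ^+ M n * 'C(2 * M n, M n)%:R) =
  (fun n => Num.sqrt (wallis R (M n) /
     (2 * ((M n)%:R / (l n)%:R ^+ 2) + (l n)%:R^-1 * (l n)%:R^-1))) :> (nat -> R).
  apply/funext => n.
  rewrite -[LHS]ger0_norm; last by rewrite mulr_ge0 ?divr_ge0 ?exprn_ge0 ?ler0n.
  rewrite -sqrtr_sqr; congr Num.sqrt; rewrite /wallis natrD natrM.
  have h : (2 * (M n)%:R + 1 : R) != 0 by rewrite gt_eqF // ltr_wpDl // mulr_ge0 ?ler0n.
  by field; rewrite p4 lR /= h.
(* [M >= tau l^2 >= tau l], and [l] tends to infinity. *)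
have Moo : M @ \oo --> \oo.
  apply/cvgnyPge => A.
  have lR0 n : (0 : R) < (l n)%:R by rewrite ltr0n.
  have e0 : 0 < tau / (A%:R + 1) by rewrite divr_gt0 // ltr_wpDl.
  have /cvgrPdist_lt/(_ _ e0) := lc; apply: filterS => n.
  rewrite sub0r normrN gtr0_norm ?invr_gt0 // => h.
  have l1 : (1 : R) <= (l n)%:R by rewrite ler1n.
  have : A%:R + 1 < tau * (l n)%:R.
    move: h; rewrite ltr_pdivlMr; last by rewrite ltr_wpDl.
    by rewrite ltr_pdivrMl // mulrC.
  have : tau * (l n)%:R <= tau * (l n)%:R ^+ 2.
    by rewrite ler_pM2l // expr2 ler_peMl // ltW.
  by have := Mge n; rewrite -(ler_nat R); lra.
apply: continuous_cvg; first exact: sqrt_continuous.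
apply: cvgM.
  exact: cvg_comp Moo (@cvg_wallis R).
apply: cvgV; first by rewrite mulf_neq0 ?pnatr_eq0 // gt_eqF.
rewrite -[X in _ --> X]addr0; apply: cvgD; first exact: cvgMl_tmp.
by rewrite -(mulr0 0); apply: cvgM.
Qed.

(** * Theta inversion *)

Lemma has_nsum_exprz (R : realType) (r : R) : 0 < r < 1 ->
  has_nsum (fun n : int => r ^+ `|n|).
Proof.
move=> /andP[r0 r1].
have h : has_nsum (fun z : int * int => r ^+ `|z.1| * r ^+ `|z.2|).
  split=> [z|]; first by rewrite mulr_ge0 ?exprn_ge0 // ltW.
  have := @summable_geometric2 R (fun z => r ^+ `|z.1| * r ^+ `|z.2|) 1 r.
  rewrite /summable; under eq_esum => z _ do
    rewrite gee0_abs ?lee_fin ?mulr_ge0 ?exprn_ge0 ?(ltW r0) //.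
  apply=> // [|z]; first by rewrite (ltW r0).
  by rewrite mul1r lexx mulr_ge0 ?exprn_ge0 // ltW.
have := has_nsum_row 0 h; rewrite /= expr0.
by under eq_fun do rewrite mul1r.
Qed.

(** Comparison with a geometric series: [(n + x)^2 >= |n| - x^2 - 1/2], from [|n| <= (n^2 + 1) / 2]
    and [(n + 2 x)^2 >= 0]. *)
Lemma has_nsum_gauss (R : realType) (c x : R) : 0 < c ->
  has_nsum (fun n : int => expR (- (c * (n%:~R + x) ^+ 2))).
Proof.
move=> c0; have r1 : 0 < expR (- c) < 1 by rewrite expR_gt0 expR_lt1 oppr_lt0.
apply: has_nsum_le (has_nsumZ (expR_ge0 (c * (x ^+ 2 + 1 / 2))) (has_nsum_exprz r1)) _.
move=> n; rewrite expR_ge0 /= -expRM_natl -expRD ler_expR natr_absz.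
have : `|n|%:~R <= n%:~R ^+ 2 / 2 + 1 / 2 :> R.
  rewrite intr_norm; have := sqr_ge0 (`|n%:~R : R| - 1).
  by rewrite sqrrB -(real_normK (num_real (n%:~R : R))); lra.
move: (`|n|%:~R : R) (n%:~R : R) => a b ab.
have h : 0 <= (b + x) ^+ 2 - a + (x ^+ 2 + 1 / 2).
  have := sqr_ge0 (b + 2 * x); nra.
have := mulr_ge0 (ltW c0) h; lra.
Qed.

Lemma normr_expR_cos (R : realType) (a b : R) : `|expR a * cos b| <= expR a.
Proof.
by rewrite normrM ger0_norm ?expR_ge0 // ler_piMr ?expR_ge0 // cos_max.
Qed.

Lemma has_nsum_gauss_cos (R : realType) (c x : R) (b : int -> R) : 0 < c ->
  has_nsum (fun n : int => `|expR (- (c * (n%:~R + x) ^+ 2)) * cos (b n)|).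
Proof.
move=> c0; apply: has_nsum_le (has_nsum_gauss x c0) _ => n.
by rewrite normr_ge0 normr_expR_cos.
Qed.

(* The sum over residues mod [l] is taken over the window [-l/2 <= x + j < l/2], on which
   the cosine power is dominated by a Gaussian. *)
Lemma cvg_sampled_cos (R : realType) (tau x w kappa : R) (l M : nat^nat)
    (s K : nat -> int) :
  polya_scale tau l M -> (forall n, s n = Num.ceil (- ((l n)%:R / 2) - x)) ->
  (forall n, (K n)%:~R / (l n)%:R = kappa) ->
  \sum_(i < l n) cos (pi * (x + (s n + i%:Z)%:~R) / (l n)%:R) ^+ (2 * M n) *
     cos (2 * pi * ((s n + i%:Z)%:~R * ((K n)%:~R / (l n)%:R) + w)) @[n --> \oo] -->
  ssum (fun j : int => expR (- (pi ^+ 2 * tau * (j%:~R + x) ^+ 2)) *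
     cos (2 * pi * (j%:~R * kappa + w))).
Proof.
move=> H sE KE; have [t0 l0 lc _ _] := H.
pose W n (j : int) := (s n <= j) && (j < s n + (l n)%:Z).
pose f n (j : int) : R := if W n j then
   cos (pi * (j%:~R + x) / (l n)%:R) ^+ (2 * M n) * cos (2 * pi * (j%:~R * kappa + w))
   else 0.
have fE n : \sum_(i < l n) cos (pi * (x + (s n + i%:Z)%:~R) / (l n)%:R) ^+ (2 * M n) *
     cos (2 * pi * ((s n + i%:Z)%:~R * ((K n)%:~R / (l n)%:R) + w)) = ssum (f n).
  have [|j|_ ->] := @ssum_seq R int [seq s n + i%:Z | i <- iota 0 (l n)] (f n).
  - by rewrite map_inj_uniq ?iota_uniq // => a b /addrI [].
  - move=> js; rewrite /f ifF //; apply: contraNF js => /andP[h1 h2].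
    apply/mapP; exists (absz (j - s n)); last by lia.
    by rewrite mem_iota; lia.
  - rewrite big_map (_ : iota 0 (l n) = index_iota 0 (l n)) ?big_mkord; last first.
      by rewrite /index_iota subn0.
    apply: eq_bigr => i _; rewrite /f ifT; last by have := ltn_ord i; rewrite /W; lia.
    by rewrite KE [x + _]addrC.
under eq_fun do rewrite fE.
have c4 : 0 < pi ^+ 2 * tau / 4 by rewrite divr_gt0 ?mulr_gt0 ?exprn_gt0 ?pi_gt0.
apply: (tannery (has_nsum_gauss x c4)) => [n j|j].
  rewrite /f; case: ifP => [/andP[h1 h2]|_]; last by rewrite normr0 expR_ge0.
  have jl : `|j%:~R + x| <= (l n)%:R / 2.
    have := ceilB1_lt (- ((l n)%:R / 2) - x); have := ceil_ge (- ((l n)%:R / 2) - x).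
    rewrite -sE rmorphB /= => a1 a2.
    have b1 : (s n)%:~R <= j%:~R :> R by rewrite ler_int.
    have b2 : j%:~R <= (s n)%:~R + (l n)%:R - 1 :> R.
      by rewrite -[(l n)%:R]/((l n)%:Z%:~R) -rmorphD -[1]/(1%:~R) -rmorphB /= ler_int; lia.
    by rewrite ler_norml; apply/andP; split; lra.
  have /andP[p0 p1] := cos_pow_le H jl.
  rewrite normrM (ger0_norm p0); apply: le_trans p1.
  by rewrite ler_piMr // cos_max.
have cf := cvg_cos_pow (y := j%:~R + x) H.
apply: cvg_trans (cvgMr_tmp (b := cos (2 * pi * (j%:~R * kappa + w))) cf).
apply: near_eq_cvg.
(* A fixed [j] lies in the window as soon as [l n > 2 (|j + x| + 1)]. *)
have e0 : 0 < (2 * (`|j%:~R + x| + 1))^-1 by rewrite invr_gt0 mulr_gt0 // ltr_wpDl.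
have /cvgrPdist_lt/(_ _ e0) := lc.
apply: filterS => n; rewrite sub0r normrN gtr0_norm ?invr_gt0 ?ltr0n //.
rewrite ltf_pV2 ?posrE ?ltr0n ?mulr_gt0 // ?ltr_wpDl // => h.
have [n1 n2] : - `|j%:~R + x| <= j%:~R + x /\ j%:~R + x <= `|j%:~R + x|.
  by rewrite ler_norm lerNl ler_normr lexx orbT.
rewrite /f ifT // /W; apply/andP; split.
  by rewrite sE ceil_le_int; lra.
rewrite -ltrBlDr sE ceil_gt_int rmorphB /= -[(l n)%:Z%:~R]/((l n)%:R); lra.
Qed.

Lemma cvg_midbin_sum (R : realType) (tau x w kappa : R) (l M : nat^nat)
    (K : nat -> int) :
  polya_scale tau l M -> 
  (forall n, (K n)%:~R / (l n)%:R = kappa) ->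
  ssum (fun b : int => (l n)%:R / 4 ^+ M n * (midbin (M n) (K n + b * (l n)%:Z))%:R *
      cos (2 * pi * ((K n + b * (l n)%:Z)%:~R * x / (l n)%:R - w))) @[n --> \oo] -->
  Num.sqrt (limn (@wallis R) / (2 * tau)) *
  ssum (fun b : int => expR (- (tau^-1 * (b%:~R + kappa) ^+ 2)) *
     cos (2 * pi * ((b%:~R + kappa) * x - w))).
Proof.
move=> H KE; have [t0 l0 lc _ _] := H.
have lR n : (l n)%:R != 0 :> R by rewrite pnatr_eq0 -lt0n.
have C0 n : ('C(2 * M n, M n)%:R : R) != 0 by rewrite pnatr_eq0 -lt0n bin_gt0; lia.
pose g n (b : int) : R := (midbin (M n) (K n + b * (l n)%:Z))%:R / 'C(2 * M n, M n)%:R *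
  cos (2 * pi * ((b%:~R + kappa) * x - w)).
have zE n (b : int) : (K n + b * (l n)%:Z)%:~R = (l n)%:R * (b%:~R + kappa) :> R.
  rewrite -(KE n) rmorphD rmorphM /= -[(l n)%:Z%:~R]/((l n)%:R).
  by field.
have c0 : 0 < (2 * (tau + 1))^-1 by rewrite invr_gt0 mulr_gt0 // addr_gt0.
have gle n b : `|g n b| <= expR (- ((2 * (tau + 1))^-1 * (b%:~R + kappa) ^+ 2)).
  have /andP[p0 p1] := midbin_le H (zE n b).
  rewrite /g normrM (ger0_norm p0); apply: le_trans p1.
  by rewrite ler_piMr // cos_max.
have gE n : ssum (fun b : int => (l n)%:R / 4 ^+ M n * (midbin (M n) (K n + b * (l n)%:Z))%:R *
      cos (2 * pi * ((K n + b * (l n)%:Z)%:~R * x / (l n)%:R - w))) =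
    (l n)%:R / 4 ^+ M n * 'C(2 * M n, M n)%:R * ssum (g n).
  rewrite -ssumZ.
    apply: eq_ssum => b; rewrite /g zE mulrA; congr (_ * cos (_ * (_ - _))).
      by field; rewrite C0 expf_neq0 // pnatr_eq0.
    by field.
  by apply: has_nsum_le (has_nsum_gauss kappa c0) _ => b; rewrite normr_ge0 gle.
under eq_fun do rewrite gE.
apply: cvgM; first exact: cvg_scale_coef H.
apply: (tannery (has_nsum_gauss kappa c0)) => // b.
apply: cvgMr_tmp; rewrite mulrC.
exact: (cvg_midbin H (fun n => zE n b)).
Qed.

Lemma theta_inversion (R : realType) (t x w : R) (d : nat) (k : int) :
  0 < t -> (0 < d)%N ->
  ssum (fun n : int => expR (- (pi * t * (n%:~R + x) ^+ 2)) *
     cos (2 * pi * (n%:~R * (k%:~R / d%:R) + w))) =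
  (Num.sqrt t)^-1 *
  ssum (fun n : int => expR (- (pi / t * (n%:~R + k%:~R / d%:R) ^+ 2)) *
     cos (2 * pi * ((n%:~R + k%:~R / d%:R) * x - w))).
Proof.
(* With [tau = t / pi], the limit of [cvg_scale_coef] is [c / sqrt t]. *)
pose c : R := Num.sqrt (limn (@wallis R) * pi / 2).
have pi0 := pi_gt0 R.
have main (t' x' w' : R) (d' : nat) (k' : int) : 0 < t' -> (0 < d')%N ->
  ssum (fun n : int => expR (- (pi * t' * (n%:~R + x') ^+ 2)) *
     cos (2 * pi * (n%:~R * (k'%:~R / d'%:R) + w'))) =
  c * (Num.sqrt t')^-1 *
  ssum (fun n : int => expR (- (pi / t' * (n%:~R + k'%:~R / d'%:R) ^+ 2)) *
     cos (2 * pi * ((n%:~R + k'%:~R / d'%:R) * x' - w'))).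
  move=> t0 d0; pose tau := t' / pi.
  have tau0 : 0 < tau by rewrite divr_gt0.
  have [M H] := polya_scale_exists tau0 d0.
  set l := (fun n => _) in H.
  pose K (n : nat) := k' * n.+1%:Z.
  have dR : d'%:R != 0 :> R by rewrite pnatr_eq0 -lt0n.
  have KE n : (K n)%:~R / (l n)%:R = k'%:~R / d'%:R :> R.
    rewrite /K /l rmorphM /= natrM -[n.+1%:Z%:~R]/(n.+1%:R).
    by rewrite -mulf_div divff ?mulr1 // pnatr_eq0.
  (* One sequence, two expressions of its limit: from the cosine powers and, through [polya_ssum],
     from the binomials. *)
  have := cvg_sampled_cos (w := w') H (fun n => erefl) KE => /(_ x').
  under eq_fun => n do rewrite (polya_ssum _ _ _ _ _ (scale_l_gt0 H n)).
  move=> /(cvg_lim (@Rhausdorff R)) h1.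
  have := cvg_midbin_sum (x := x') (w := w') H KE => /(cvg_lim (@Rhausdorff R)) h2.
  rewrite h1 in h2.
  have e1 : pi ^+ 2 * tau = pi * t' by rewrite /tau expr2 -mulrA (mulrCA pi t') divff ?mulr1 ?gt_eqF.
  have e2 : tau^-1 = pi / t' by rewrite /tau invf_div.
  rewrite e1 e2 in h2; rewrite h2; congr (_ * _).
  rewrite [RHS]mulrC /c -sqrtrV -?sqrtrM ?invr_ge0 ?(ltW t0) //.
  congr Num.sqrt; rewrite /tau; clear -pi0 t0.
  by move: pi pi0 (limn _) => p p0 W; field; rewrite !gt_eqF.
move=> t0 d0; rewrite main // (_ : c = 1) ?mul1r //.
(* At this self-dual point the formula reads [th = c * th], and [th > 0] because its term at 0 is
   1. *)
have := main 1 0 0 1%N 0 ltr01 isT.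
rewrite sqrtr1 invr1 mulr1 mul0r.
pose th : R := ssum (fun n : int => expR (- (pi * (n%:~R + 0) ^+ 2)) * 1).
do 2!(rewrite (_ : ssum _ = th);
  last by apply: eq_ssum => n; rewrite !(mulr0, addr0, subr0, cos0)).
move=> thE; have th0 : 0 < th.
  have hg := has_nsum_gauss 0 pi0.
  rewrite /th; under eq_fun do rewrite mulr1.
  rewrite ssum_nsum //.
  pose p (n : int) : R := if n == 0 then 1 else 0.
  have [|n|hp pE] := @nsum_seq R int [:: 0] p isT.
  - by move=> n; rewrite /p; case: ifP.
  - by rewrite inE /p => /negbTE ->.
  apply: lt_le_trans (_ : nsum p <= _).
    by rewrite pE big_seq1 /p eqxx ltr01.
  apply: le_nsum => // n; rewrite /p; case: eqP => [->|_].
    by rewrite addr0 expr0n mulr0 oppr0 expR0 ler01 lexx.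
  by rewrite lexx expR_ge0.
by apply: (mulIf (lt0r_neq0 th0)); rewrite mul1r [RHS]thE mulr1.
Qed.

(** * Two variables *)

Lemma ord2_cases (i : 'I_2) : i = 0 \/ i = 1.
Proof. by case: i => [[|[|//]] hi]; [left|right]; exact: val_inj. Qed.

Lemma det_mx2 (R : comNzRingType) (A : 'M[R]_2) :
  \det A = A 0 0 * A 1 1 - A 0 1 * A 1 0.
Proof.
have l0 : lift ord0 ord0 = 1 :> 'I_2 by exact: val_inj.
have l1 : lift 1 ord0 = 0 :> 'I_2 by exact: val_inj.
rewrite (expand_det_row _ 0) !big_ord_recl big_ord0 l0 addr0 /cofactor.
rewrite !det_mx11 !mxE l0 l1 /= expr0 expr1 mul1r mulN1r mulrN.
by [].
Qed.

Lemma symmetricmx2 (R : realType) (A : 'M[R]_2) :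
  (A \is symmetricmx) = (A 1 0 == A 0 1).
Proof.
rewrite qualifE /= expr0 scale1r map_mx_id //.
apply/eqP/eqP => [h|h]; first by rewrite {1}h mxE.
apply/matrixP => i k; rewrite mxE.
by have [->|->] := ord2_cases i; have [->|->] := ord2_cases k.
Qed.

Definition pair_row (R : realType) (x y : R) : 'rV[R]_2 :=
  \row_(i < 2) if i == 0 then x else y.

Lemma qform_complete_square (R : realType) (A : 'M[R]_2) (v : 'rV[R]_2) :
  A \is symmetricmx -> A 0 0 != 0 ->
  qform A v = A 0 0 * (v 0 0 + A 0 1 / A 0 0 * v 0 1) ^+ 2 +
              \det A / A 0 0 * v 0 1 ^+ 2.
Proof.
move=> sym a0; have := sym; rewrite symmetricmx2 => /eqP s10.
by rewrite qformE // det_mx2 s10; field.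
Qed.

Lemma posdef_gt0 (R : realType) (A : 'M[R]_2) :
  A \is symmetricmx -> posdef A -> 0 < A 0 0 /\ 0 < \det A.
Proof.
move=> sym pos.
have wP x y : (x != 0) || (y != 0) -> 0 < qform A (pair_row x y).
  move=> xy; apply: pos; apply: contraTneq xy => /rowP w0.
  by move: (w0 0) (w0 1); rewrite !mxE /= => -> ->; rewrite eqxx.
have a0 : 0 < A 0 0.
  have := wP 1 0; rewrite oner_eq0 qformE // !mxE /= => /(_ isT).
  by rewrite expr1n expr0n !mulr0 !addr0 mulr1.
(* The test vector [(- b / a, 1)] annihilates the completed square and leaves [det / a]. *)
split=> //; have := wP (- (A 0 1 / A 0 0)) 1.
rewrite oner_eq0 orbT qform_complete_square ?gt_eqF // !mxE /= => /(_ isT).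
by rewrite mulr1 addNr expr0n mulr0 add0r expr1n mulr1 pmulr_lgt0 ?invr_gt0.
Qed.

(** Adjugate formula; subtraction in ['I_2] is mod 2, so [1 - i] is the index other than [i]. *)
Lemma invmx2 (R : realType) (A : 'M[R]_2) : \det A != 0 ->
  invmx A = (\det A)^-1 *: \matrix_(i, k)
    if i == k then A (1 - i) (1 - i) else - A i k.
Proof.
move=> D0; set B := (X in _ = X).
have sub0' : 1 - 0 = 1 :> 'I_2 by exact: val_inj.
have sub1' : 1 - 1 = 0 :> 'I_2 by exact: val_inj.
have BA : B *m A = 1%:M.
  have l0 : lift ord0 ord0 = 1 :> 'I_2 by exact: val_inj.
  apply/matrixP => i k; rewrite !mxE !big_ord_recl big_ord0 l0 !mxE addr0.
  have [->|->] := ord2_cases i; have [->|->] := ord2_cases k;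
    rewrite /= ?sub0' ?sub1'; move: D0; rewrite det_mx2 => D0; by field.
have [_ uA] := mulmx1_unit BA.
by rewrite -[LHS]mul1mx -BA -mulmxA mulmxV // mulmx1.
Qed.

(** The square is completed in the second variable, as the exponents produced by the two theta
    inversions require. *)
Lemma qform_invmx (R : realType) (A : 'M[R]_2) (v : 'rV[R]_2) :
  A \is symmetricmx -> posdef A ->
  qform (invmx A) v = (A 0 0)^-1 * v 0 0 ^+ 2 +
     A 0 0 / \det A * (v 0 1 - A 0 1 / A 0 0 * v 0 0) ^+ 2.
Proof.
move=> sym pos; have [a0 D0] := posdef_gt0 sym pos.
have := sym; rewrite symmetricmx2 => /eqP s10.
have sub0' : 1 - 0 = 1 :> 'I_2 by exact: val_inj.
have sub1' : 1 - 1 = 0 :> 'I_2 by exact: val_inj.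
have D0' : \det A != 0 by rewrite gt_eqF.
have iE := invmx2 D0'.
rewrite qformE; last by rewrite iE symmetricmx2 !mxE /= s10.
rewrite iE !mxE /= sub0' sub1'.
move: D0'; rewrite det_mx2 s10 => D0'; field.
by rewrite D0' gt_eqF.
Qed.

Lemma posdef_invmx (R : realType) (A : 'M[R]_2) :
  A \is symmetricmx -> posdef A -> invmx A \is symmetricmx /\ posdef (invmx A).
Proof.
move=> sym pos; have [a0 D0] := posdef_gt0 sym pos.
have := sym; rewrite symmetricmx2 => /eqP s10.
split; first by rewrite invmx2 ?gt_eqF // symmetricmx2 !mxE /= s10.
move=> v v0; rewrite qform_invmx //.
have h1 : 0 < (A 0 0)^-1 by rewrite invr_gt0.
have h2 : 0 < A 0 0 / \det A by rewrite divr_gt0.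
have [x0|x0] := eqVneq (v 0 0) 0.
  have y0 : v 0 1 != 0.
    apply: contra v0 => /eqP y0; apply/eqP/rowP => i; rewrite mxE.
    by have [->|->] := ord2_cases i.
  by rewrite x0 expr0n !mulr0 add0r subr0 pmulr_rgt0 // exprn_even_gt0.
apply: ltr_pwDl; last by rewrite mulr_ge0 ?sqr_ge0 ?(ltW h2).
by rewrite mulr_gt0 // exprn_even_gt0.
Qed.

(** * Gaussian sums over the whole lattice *)

Lemma has_nsum_gaussian_term (R : realType) (d : nat) (A : 'M[R]_2) (n : int * int) :
  (0 < d)%N -> A \is symmetricmx -> posdef A -> has_nsum (gaussian_term d A n).
Proof.
move=> d0 sym pos; have := gaussian_summable n d0 sym pos.
rewrite /summable => h; split=> [z|]; first exact: expR_ge0.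
by move: h; under eq_esum do rewrite gee0_abs ?lee_fin ?expR_ge0 //.
Qed.

(** The Gaussian on the lattice before periodisation: its values at the translates of [n] are the
    terms of [gaussian d A n]. *)
Definition gauss2 (R : realType) (d : nat) (A : 'M[R]_2) (N : int * int) : R :=
  expR (- (pi / d%:R) * qform A (int_row R N)).

(** This is the summability of [gaussian_term] with period 1, base point 0 and matrix [A / d]. *)
Lemma has_nsum_gauss2 (R : realType) (d : nat) (A : 'M[R]_2) :
  (0 < d)%N -> A \is symmetricmx -> posdef A -> has_nsum (gauss2 d A).
Proof.
move=> d0 sym pos; have dR : (0 : R) < d%:R by rewrite ltr0n.
have qZ (v : 'rV[R]_2) : qform (d%:R^-1 *: A) v = d%:R^-1 * qform A v.
  by rewrite /qform -scalemxAr -scalemxAl mxE.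
have sym' : d%:R^-1 *: A \is symmetricmx.
  by move: sym; rewrite !symmetricmx2 !mxE => /eqP ->.
have pos' : posdef (d%:R^-1 *: A).
  by move=> v v0; rewrite qZ mulr_gt0 ?invr_gt0 // pos.
have := has_nsum_gaussian_term (0, 0) (ltn0Sn 0) sym' pos'.
congr has_nsum; apply/funext => N.
rewrite /gaussian_term /gauss2 qZ divr1 mulrA /translate /= !mulr1 !add0r.
by case: N => N1 N2 /=; rewrite !mulNr.
Qed.

(** Theta inversion at [1 / s] with [k = 0], read from right to left; replacing [n] by [- n] turns
    [(n + y)^2] into [(n - y)^2]. *)
Lemma theta_real_shift (R : realType) (s y : R) : 0 < s ->
  ssum (fun n : int => expR (- (pi * s * n%:~R ^+ 2)) * cos (2 * pi * (n%:~R * y))) =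
  (Num.sqrt s)^-1 * nsum (fun n : int => expR (- (pi / s * (n%:~R - y) ^+ 2))).
Proof.
move=> s0; have si : 0 < s^-1 by rewrite invr_gt0.
have := @theta_inversion R s^-1 y 0 1 0 si isT.
rewrite sqrtrV ?ltW // invrK invrK => h.
have s1 : Num.sqrt s != 0 by rewrite sqrtr_eq0 -ltNge.
have e1 : ssum (fun n : int => expR (- (pi * s * n%:~R ^+ 2)) * cos (2 * pi * (n%:~R * y))) =
   ssum (fun n : int => expR (- (pi * s * (n%:~R + 0%:~R / 1%:R) ^+ 2)) *
       cos (2 * pi * ((n%:~R + 0%:~R / 1%:R) * y - 0))).
  by apply: eq_ssum => n; rewrite mulr0z mul0r addr0 subr0.
rewrite e1; apply: (mulfI s1); rewrite -h mulrA divff // mul1r.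
rewrite -ssum_nsum; last by have := has_nsum_gauss (- y) (divr_gt0 (pi_gt0 R) s0).
rewrite (@reindex_ssum _ _ _ (fun n : int => - n)); last 2 first.
- exact: oppr_inj.
- by move=> z []; exists (- z) => //; rewrite opprK.
apply: eq_ssum => n /=; rewrite mulr0z mul0r mulr0 addr0 mulr0 cos0 mulr1.
by congr (expR (- (_ * _))); rewrite rmorphN /= -sqrrN opprD opprK.
Qed.

Lemma ssum_gauss2 (R : realType) (d : nat) (A : 'M[R]_2) (k : int * int) :
  (0 < d)%N -> A \is symmetricmx -> posdef A ->
  ssum (fun N => gauss2 d A N * cos (2 * pi / d%:R * (k.1 * N.1 + k.2 * N.2)%:~R)) =
  d%:R / Num.sqrt (\det A) * gaussian d (invmx A) k.
Proof.
move=> d0 sym pos; have [a0 D0] := posdef_gt0 sym pos.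
have [symV posV] := posdef_invmx sym pos.
have dR : (0 : R) < d%:R by rewrite ltr0n.
have pi0 := pi_gt0 R.
set a := A 0 0 in a0 *; set D := \det A in D0 *; pose b := A 0 1.
(* The exponent is [- pi t (N1 + b N2 / a)^2 - pi s N2^2]. *)
pose t := a / d%:R; pose s := D / (a * d%:R).
have t0 : 0 < t by rewrite divr_gt0.
have s0 : 0 < s by rewrite divr_gt0 ?mulr_gt0.
pose k1 : R := k.1%:~R / d%:R; pose k2 : R := k.2%:~R / d%:R.
have hF : has_nsum (fun N : int * int => `|gauss2 d A N *
    cos (2 * pi / d%:R * (k.1 * N.1 + k.2 * N.2)%:~R)|).
  apply: has_nsum_le (has_nsum_gauss2 d0 sym pos) _ => N.
  by rewrite normr_ge0 normr_expR_cos.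
rewrite ssum_pair // ssum_exchange; last by move: hF; congr has_nsum; apply/funext => -[].
pose u (m : int) : R := expR (- (pi / t * (m%:~R + k1) ^+ 2)).
pose v (m : int) : R := expR (- (pi * s * m%:~R ^+ 2)).
(* Coefficient of [N2] in the phase left by the inversion in [N1]. *)
pose y (m : int) : R := (m%:~R + k1) * (b / a) - k2.
have row (N2 : int) : ssum (fun N1 : int => gauss2 d A (N1, N2) *
     cos (2 * pi / d%:R * (k.1 * N1 + k.2 * N2)%:~R)) =
   (Num.sqrt t)^-1 * ssum (fun m => u m * (v N2 * cos (2 * pi * (N2%:~R * y m)))).
  have := @theta_inversion R t (b / a * N2%:~R) (k2 * N2%:~R) d k.1 t0 d0.
  set L := ssum _; set Q := ssum _ => LQ.
  transitivity (v N2 * L).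
    rewrite /L -ssumZ; last exact: has_nsum_gauss_cos (mulr_gt0 pi0 t0).
    apply: eq_ssum => N1; rewrite /v mulrA -expRD; congr (expR _ * cos _).
      rewrite qform_complete_square ?gt_eqF // !mxE /= -/a -/b -/D /t /s.
      move: (pi : R) => p; field; rewrite !gt_eqF //.
    rewrite rmorphD !rmorphM /= /k2; move: (pi : R) => p; field; rewrite gt_eqF //.
  rewrite LQ mulrCA; congr (_ * _); rewrite /Q -ssumZ; last first.
    exact: has_nsum_gauss_cos (divr_gt0 pi0 t0).
  apply: eq_ssum => m; rewrite /u -/k1 mulrCA; congr (_ * (_ * cos (_ * _))).
  by rewrite /y; ring.
under eq_ssum do rewrite row.
have hu : has_nsum u := has_nsum_gauss k1 (divr_gt0 pi0 t0).
have hv : has_nsum v.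
  have := has_nsum_gauss 0 (mulr_gt0 pi0 s0).
  by under eq_fun do rewrite addr0.
have huv : has_nsum (fun z : int * int => `|u z.2 * (v z.1 * cos (2 * pi * (z.1%:~R * y z.2)))|).
  apply: has_nsum_le (has_nsum_comp (e := fun z : int * int => (z.2, z.1)) _ (has_nsumM hu hv)) _.
    by move=> [? ?] [? ?] [-> ->].
  move=> z /=; rewrite normr_ge0 normrM ger0_norm ?expR_ge0 // ler_wpM2l ?expR_ge0 //.
  exact: normr_expR_cos.
rewrite ssumZ; last first.
  exact: (has_nsum_ssum (f := fun z => u z.2 * (v z.1 * cos (2 * pi * (z.1%:~R * y z.2)))) huv).
rewrite (ssum_exchange (f := fun N m => u m * (v N * cos (2 * pi * (N%:~R * y m))))) //.
have col (m : int) : ssum (fun N2 : int => u m * (v N2 * cos (2 * pi * (N2%:~R * y m)))) =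
   (Num.sqrt s)^-1 * nsum (fun n => gaussian_term d (invmx A) k (m, n)).
  rewrite ssumZ; last first.
    have := has_nsum_gauss_cos 0 (fun n => 2 * pi * (n%:~R * y m)) (mulr_gt0 pi0 s0).
    by under eq_fun do rewrite addr0.
  rewrite theta_real_shift // mulrCA; congr (_ * _).
  rewrite -nsumZ ?expR_ge0 //; last exact: has_nsum_gauss (divr_gt0 pi0 s0).
  congr nsum; apply/funext => n; rewrite /u -expRD /gaussian_term; congr expR.
  (* The lattice point is [d] times [(m + k1, n + k2)], which matches [pi / t] and [pi / s] with the
     two squares. *)
  rewrite qform_invmx // !mxE /= -/a -/b -/D !rmorphD !rmorphM /= -[d%:Z%:~R]/(d%:R).
  rewrite /t /s /y /k1 /k2; move: (pi : R) => p; field; rewrite !gt_eqF //.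
under eq_ssum do rewrite col.
have hG := has_nsum_gaussian_term k d0 symV posV.
have [h1 h2] := nsum_pair hG.
rewrite ssumZ; last first.
  apply: has_nsum_le h1 _ => m; rewrite normr_ge0 ger0_norm ?lexx //.
  by apply: nsum_ge0 => n; exact: expR_ge0.
rewrite ssum_nsum // h2 mulrA -[nsum _]/(gaussian d (invmx A) k); congr (_ * _).
rewrite -invfM -sqrtrM ?(ltW t0) //.
have -> : t * s = D / d%:R ^+ 2 by rewrite /t /s; field; rewrite !gt_eqF.
by rewrite sqrtrM ?(ltW D0) // sqrtrV ?sqr_ge0 // sqrtr_sqr gtr0_norm // invf_div.
Qed.

(** * Residue classes and the complex-valued transform *)

Lemma sum_complex (R : realType) (r : seq nat) (f g : nat -> R) :
  \sum_(i <- r) (f i +i* g i)%C = ((\sum_(i <- r) f i) +i* (\sum_(i <- r) g i))%C.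
Proof. by elim: r => [|i r ih]; rewrite ?big_nil // !big_cons ih. Qed.

Lemma gaussianN (R : realType) (d : nat) (A : 'M[R]_2) (n : int * int) :
  gaussian d A (- n.1, - n.2) = gaussian d A n.
Proof.
rewrite /gaussian; congr fine.
rewrite [RHS](@reindex_esum _ _ _ setT setT (fun al : int * int => (- al.1, - al.2))).
  apply: eq_esum => al _; congr (expR (_ * _))%:E.
  rewrite /qform (_ : int_row R _ = - int_row R (translate d n (- al.1, - al.2))).
    by rewrite mulNmx linearN /= mulNmx mulmxN opprK.
  apply/rowP => i; rewrite !mxE -mulrNz; congr (_ *~ _).
  by case: ifP => _ /=; ring.
split=> [//|[? ?] [? ?] _ _ [/oppr_inj -> /oppr_inj ->] //|[x y] _].
by exists (- x, - y) => //=; rewrite !opprK.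
Qed.

Lemma cos_translate (R : realType) (d : nat) (k n al : int * int) : (0 < d)%N ->
  cos (2 * pi / d%:R * (k.1 * (translate d n al).1 + k.2 * (translate d n al).2)%:~R)
  = cos (2 * pi / d%:R * (k.1 * n.1 + k.2 * n.2)%:~R) :> R.
Proof.
move=> d0; have dR : d%:R != 0 :> R by rewrite pnatr_eq0 -lt0n.
rewrite -[RHS](cosDint _ (k.1 * al.1 + k.2 * al.2)); congr cos.
rewrite /translate /= !(rmorphD, rmorphM) /= -[d%:Z%:~R]/(d%:R).
by move: (pi : R) => p; field.
Qed.

(** The symmetric representatives of the classes mod [2 j + 1], indexed as in [dft]. *)
Definition residue (j : nat) (m : nat) : int := m%:Z - j%:Z.

(** Reversing both ranges, [m -> 2 j - m], negates the residues, so the sum is its own opposite. *)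
Lemma sum_residue_odd (R : realType) (j : nat) (F : int -> int -> R) :
  (forall x y, F (- x) (- y) = - F x y) ->
  \sum_(0 <= m1 < 2 * j + 1) \sum_(0 <= m2 < 2 * j + 1)
    F (residue j m1) (residue j m2) = 0.
Proof.
move=> FN; set S := (X in X = _).
suff : S = - S by move=> SN; lra.
rewrite {1}/S big_nat_rev /= -sumrN big_nat [RHS]big_nat.
apply: eq_bigr => m1 m1d; rewrite big_nat_rev /= -sumrN big_nat [RHS]big_nat.
apply: eq_bigr => m2 m2d; rewrite -FN /residue; congr F; lia.
Qed.

(** Euclidean division by [d] in each coordinate makes [e] a bijection onto the lattice. *)
Lemma sum_residue_ssum (R : realType) (j : nat) (F : int * int -> R) :
  has_nsum (fun N => `|F N|) ->
  ssum F = \sum_(0 <= m1 < 2 * j + 1) \sum_(0 <= m2 < 2 * j + 1)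
    ssum (fun alpha => F (translate (2 * j + 1) (residue j m1, residue j m2) alpha)).
Proof.
set d := (2 * j + 1)%N => hF.
pose e (z : ('I_d * 'I_d) * (int * int)) :=
  translate d (residue j z.1.1, residue j z.1.2) z.2.
have inj1 (m m' : 'I_d) (al al' : int) :
    residue j m + al * d%:Z = residue j m' + al' * d%:Z -> m = m' /\ al = al'.
  move=> h; have mm : m%:Z + al * d%:Z = m'%:Z + al' * d%:Z.
    by move: h; rewrite /residue; lia.
  have := ltn_ord m; have := ltn_ord m'.
  (* Two residues differ by less than [d], hence by no nonzero multiple of [d]. *)
  have aa : al = al'.
    have := ltn_ord m; have := ltn_ord m'; move: mm; rewrite /d; nia.
  by split=> //; apply: val_inj => /=; move: mm; rewrite aa => /addIr [].
have inj : injective e.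
  move=> [[m1 m2] [a1 a2]] [[m1' m2'] [a1' a2']] [/inj1[-> ->] /inj1[-> ->]] //.
have surj1 (x : int) : exists m : 'I_d, exists al, x = residue j m + al * d%:Z.
  have d0 : d%:Z != 0 by rewrite /d; lia.
  have m0 := modz_ge0 (x + j%:Z) d0.
  have md : (`|((x + j%:Z) %% d)%Z| < d)%N.
    by have := ltz_pmod (x + j%:Z) (d := d%:Z) ltac:(rewrite /d; lia); lia.
  exists (Ordinal md), ((x + j%:Z) %/ d)%Z.
  have := divz_eq (x + j%:Z) d; rewrite /residue /= gez0_abs //; lia.
rewrite (reindex_ssum inj); last first.
  move=> [x y] []; have [m1 [a1 ->]] := surj1 x; have [m2 [a2 ->]] := surj1 y.
  by exists ((m1, m2), (a1, a2)).
rewrite ssum_pair; last exact: has_nsum_comp inj hF.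
rewrite ssum_fin big_mkord.
under [RHS]eq_bigr do rewrite big_mkord.
by rewrite pair_bigA.
Qed.

Local Open Scope complex_scope.

Theorem theorem1 (R : realType) (j : nat) (sigma : 'M[R]_2)
    (sigma_sym : sigma \is symmetricmx) (sigma_pos : posdef sigma) :
  dft j (fun n => (gaussian (2 * j + 1) sigma n)%:C) =
  (fun k => ((Num.sqrt (\det sigma))^-1 *
             gaussian (2 * j + 1) (invmx sigma) k)%:C).
Proof.
apply/funext => k; rewrite /dft; set d := (2 * j + 1)%N.
have d0 : (0 < d)%N by rewrite /d addn1.
have dR : d%:R != 0 :> R by rewrite pnatr_eq0 -lt0n.
pose ph (x y : int) : R := 2 * pi / d%:R * (k.1 * x + k.2 * y)%:~R.
pose g := gaussian d sigma.
have expE (n : int * int) : expi (- (2 * pi / d%:R) * (k.1 * n.1 + k.2 * n.2)%:~R) *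
   ((gaussian d sigma n)%:C)%C = ((cos (ph n.1 n.2) * g n) +i* (- (sin (ph n.1 n.2) * g n)))%C.
  by rewrite /expi mulNr cosN sinN; apply/eqP; rewrite eq_complex /= !mulr0 subr0 add0r mulNr !eqxx.
under eq_bigr => m1 _.
  under eq_bigr => m2 _ do rewrite expE /=.
  rewrite sum_complex.
  over.
rewrite sum_complex.
under [X in (_ +i* X)%C]eq_bigr do rewrite sumrN.
(* The imaginary part vanishes: the sine is odd and [g] is even. *)
rewrite sumrN (@sum_residue_odd _ j (fun x y => sin (ph x y) * g (x, y))); last first.
  move=> x y; rewrite /g (gaussianN d sigma (x, y)) -mulNr -sinN; congr (sin _ * _).
  by rewrite /ph -mulrN -rmorphN /= !mulrN opprD.
have hF : has_nsum (fun N : int * int => `|gauss2 d sigma N *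
    cos (2 * pi / d%:R * (k.1 * N.1 + k.2 * N.2)%:~R)|).
  apply: has_nsum_le (has_nsum_gauss2 d0 sigma_sym sigma_pos) _ => N.
  by rewrite normr_ge0 normr_expR_cos.
(* The phase is constant mod [2 pi] on a class, so the cosine factors out of the sum over the
   class. *)
have termE n : ssum (fun al => gauss2 d sigma (translate d n al) *
     cos (2 * pi / d%:R * (k.1 * (translate d n al).1 + k.2 * (translate d n al).2)%:~R)) =
     cos (ph n.1 n.2) * g n.
  have hg := has_nsum_gaussian_term n d0 sigma_sym sigma_pos.
  rewrite /g -[gaussian d sigma n]/(nsum (gaussian_term d sigma n)) -ssum_nsum //.
  rewrite -ssumZ; last first.
    apply: has_nsum_le hg _ => al; rewrite normr_ge0 ger0_norm ?lexx //.
    exact: expR_ge0.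
  by apply: eq_ssum => al; rewrite mulrC; congr (_ * _); exact: cos_translate.
have := ssum_gauss2 k d0 sigma_sym sigma_pos.
rewrite (sum_residue_ssum j hF) -/d.
under eq_bigr do under eq_bigr do rewrite termE.
move=> /= SE; rewrite /residue in SE.
rewrite SE oppr0 -[(_ +i* 0)%C]/(_%:C)%C -(rmorph_nat (real_complex R)) -fmorphV -rmorphM /=.
by rewrite !mulrA mulVf // mul1r.
Qed.
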